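(* Consider the measurement model $\mathbf y=\mathbf O\mathbf x_0^*+\sum_{j=1}^m\mathbf J_j\mathbf u_j^*+\mathbf v$ with $\mathbf v\sim\mathcal N(\mathbf 0,\sigma^2\mathbf I_T)$ and active set $S=\{j:\mathbf u_j^*\neq \mathbf 0\}=\{1,\dots,m^*\}$ (notation and standing assumptions as in the context). Suppose that: (A1) $\max\{\|\mathbf O\|_2,\|\mathbf J_1\|_2,\dots,\|\mathbf J_m\|_2\}\le C\sqrt T<\infty$ for a constant $C$; (A2) with $\mathbf M=\mathbf I-\boldsymbol\Psi_{S,[d-1:0]}\boldsymbol\Psi_{S,[d-1:0]}^+$, $\left\|\left(\tfrac1T\boldsymbol\Psi_{S,[N:d]}^{\mathsf T}\mathbf M\boldsymbol\Psi_{S,[N:d]}\right)^{+}\right\|_2\le \frac1{c_{\min}}<\infty$; (A3) for some $\alpha\in[0,1)$, $\max_{j\in S^c}\|\mathbf J_j^{\mathsf T}\boldsymbol\Psi_S(\boldsymbol\Psi_S^{\mathsf T}\boldsymbol\Psi_S)^+\|_2\le \alpha/m^*$. Let $\delta>0$, $\delta_1\in(0,1)$, $c_1=\log5$ and $$\lambda_T=\frac{\sqrt{32}\,C\sigma}{1-\alpha}\left\{\sqrt{\frac{(N+1)c_1+\log(m-m^* )}{T}}+\frac{\delta}{2}\right\}.$$ Let $t_S=(N-d+1)m^*$, $\boldsymbol\Pi_{S,[0:N-d]}=[\mathbf 0_{t_S\times n}\ \mathbf I_{t_S}\ \mathbf 0_{t_S\times dm^*}]$, and suppose that $\min_{j\in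 S}\|\mathbf u^*_{j,[0:N-d]}\|_\infty\ge\beta_{\min}$, where $$\beta_{\min}=\frac{\sigma}{\sqrt{c_{\min}}}\left\{\sqrt{\frac{2\log t_S}{T}}+\delta\right\}+\lambda_T\left\|\boldsymbol\Pi_{S,[0:N-d]}\left(\frac{\boldsymbol\Psi_S^{\mathsf T}\boldsymbol\Psi_S}{T}\right)^+\right\|_\infty .$$ Let $\widehat S=\{j:\widehat{\mathbf u}_j\neq\mathbf 0\}$ for an optimal solution $(\widehat{\mathbf x}_0,\widehat{\mathbf u}_1,\dots,\widehat{\mathbf u}_m)$ of $$\min_{\mathbf x_0\in\mathbb R^n,\ \mathbf u_1,\dots,\mathbf u_m\in\mathbb R^{N+1}}\ \frac1{2T}\Big\|\mathbf y-\mathbf O\mathbf x_0-\sum_{j=1}^m\mathbf J_j\mathbf u_j\Big\|_2^2+\lambda_T\sum_{j=1}^m\|\mathbf u_j\|_2,$$ and let $\widehat{\boldsymbol\beta}^{(OLS)}_{\widehat S,[0:N-d]}=\widetilde{\boldsymbol\Pi}_{\widehat S,[0:N-d]}\,\boldsymbol\Psi_{\widehat S}^+\mathbf y$. Then, with probability at least $1-4\exp(-T\delta^2/2)-\delta_1$, $$\big\|\boldsymbol\beta^*_{S,[0:N-d]}-\widehat{\boldsymbol\beta}^{(OLS)}_{\widehat S,[0:N-d]}\big\|_2\le\frac{4\sigma}{\sqrt{c_{\min}}}\sqrt{\frac{n+t_S}{T}}+\frac{2\sigma}{\sqrt{c_{\min}}}\sqrt{\frac1T\log\Big(\frac1{\delta_1}\Big)}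 .$$
   Context: Setting. $n,m,p,N$ are positive integers, $\mathbf A\in\mathbb R^{n\times n}$, $\mathbf B=[\mathbf b_1,\dots,\mathbf b_m]\in\mathbb R^{n\times m}$, $\mathbf C\in\mathbb R^{p\times n}$, $T=p(N+1)$, $\sigma>0$, $c_{\min}>0$. These come from the system $\mathbf x[k+1]=\mathbf A\mathbf x[k]+\mathbf B\mathbf u^*[k]$, $\mathbf y[k]=\mathbf C\mathbf x[k]+\mathbf v[k]$, with i.i.d. $\mathbf v[k]\sim\mathcal N(\mathbf 0,\sigma^2\mathbf I_p)$, unknown initial state $\mathbf x[0]=\mathbf x_0^*$ and $\mathbf u^*[k]=(u_1^*[k],\dots,u_m^*[k])^{\mathsf T}$, observed for $k=0,\dots,N$; $\mathbf y,\mathbf v\in\mathbb R^T$ stack $\mathbf y[k],\mathbf v[k]$ over $k=0,\dots,N$, and $\mathbf u_j^*=(u_j^*[0],\dots,u_j^*[N])^{\mathsf T}$. Matrices. $\mathbf O\in\mathbb R^{T\times n}$ stacks $\mathbf C,\mathbf C\mathbf A,\dots,\mathbf C\mathbf A^N$. $\mathbf J_j\in\mathbb R^{T\times(N+1)}$ is the block lower triangular Toeplitz matrix whose $(a,b)$ block ($0\le a,b\le N$) is $\mathbf H^{(j)}_{a-b}$ for $a\ge b$ and $\mathbf 0$ otherwise, where $\mathbf H^{(j)}_0=\mathbf 0\in\mathbb R^{p\times1}$ and $\mathbf H^{(j)}_l=\mathbf C\mathbf A^{l-1}\mathbf b_j$ for $l\ge1$. For $R\subset\{1,\dots,m\}$: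 $\mathbf B_R$ is the matrix of columns $\mathbf b_j$, $j\in R$; $\mathbf H_0^{(R)}=\mathbf 0_{p\times |R|}$, $\mathbf H_l^{(R)}=\mathbf C\mathbf A^{l-1}\mathbf B_R$ for $l\ge1$. For $k\ge0$, $\mathbf J_{R,[k:0]}\in\mathbb R^{p(k+1)\times |R|(k+1)}$ is the block lower triangular Toeplitz matrix with $(a,b)$ block $\mathbf H^{(R)}_{a-b}$ for $a\ge b$, $0\le a,b\le k$ (and $\mathbf 0$ otherwise); $\mathbf J_{R,[-1:0]}$ is empty, of rank $0$. $\mathbf J_R=\mathbf J_{R,[N:0]}$; its block columns ($|R|$ columns each), read from left to right, are $\mathbf M_N^{(R)},\dots,\mathbf M_0^{(R)}$. $\boldsymbol\Psi_R=[\mathbf O\ \mathbf J_R]$, $\boldsymbol\Psi_{R,[N:d]}=[\mathbf O\ \mathbf M^{(R)}_N\cdots\mathbf M^{(R)}_d]$, $\boldsymbol\Psi_{R,[d-1:0]}=[\mathbf M^{(R)}_{d-1}\cdots\mathbf M^{(R)}_0]$ (empty if $d=0$). $\widetilde{\boldsymbol\Pi}_{R,[0:N-d]}=[\mathbf I_{n+t_R}\ \ \mathbf 0_{(n+t_R)\times d|R|}]$ with $t_R=(N-d+1)|R|$. Active set. $S=\{j:\mathbf u_j^*\ne\mathbf 0\}$, $S^c=\{1,\dots,m\}\setminus S$, $m^*=|S|$, $1\le m^*<m$. $\mathbf u^*_S[k]=(u_j^*[k])_{j\in S}$, and $\boldsymbol\beta^*_{S,[0:N-d]}$ is the vector stacking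 $\mathbf x_0^*,\mathbf u_S^*[0],\dots,\mathbf u_S^*[N-d]$. (The event in the conclusion is understood as: $\widehat S=S$, so that the two vectors have the same length, and the inequality holds.) Delays. $\eta_S$ is the smallest $d\ge0$ with $\operatorname{Rank}\mathbf J_{S,[d:0]}-\operatorname{Rank}\mathbf J_{S,[d-1:0]}=m^*$ ($\infty$ if none). $\mu_S$ is the smallest $d\ge0$ with $\operatorname{Rank}[\mathbf O_d\ \mathbf J_{S,[d:0]}]-\operatorname{Rank}\mathbf J_{S,[d:0]}=n$, where $\mathbf O_d$ stacks $\mathbf C,\mathbf C\mathbf A,\dots,\mathbf C\mathbf A^d$ ($\infty$ if none). Standing assumptions: $\eta_S,\mu_S<\infty$, $d=\eta_S$, $N\ge\max\{\eta_S,\mu_S\}$. Notation. $\mathbf X^+$ is the Moore–Penrose pseudoinverse; for matrices $\|\cdot\|_2$ is the spectral norm and $\|\cdot\|_\infty$ the norm induced by the vector $\ell_\infty$-norm. For $\mathbf w=(w[0],\dots,w[N])$, $\mathbf w_{[0:N-d]}=(w[0],\dots,w[N-d])$. *)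

(* Defs.v *)
From HB Require Import structures.
From mathcomp Require Import all_boot all_order all_algebra.
From mathcomp Require Import all_classical all_reals all_analysis.

Set Implicit Arguments.
Unset Strict Implicit.
Unset Printing Implicit Defensive.

Import Order.TTheory GRing.Theory Num.Theory.
Import numFieldNormedType.Exports.

Local Open Scope classical_set_scope.
Local Open Scope ring_scope.

Definition l2norm (R : realType) (k : nat) (x : 'cV[R]_k) : R :=
  Num.sqrt (\sum_i x i 0 ^+ 2).

Definition l2_opnorm (R : realType) (k l : nat) (A : 'M[R]_(k, l)) : R :=
  sup [set l2norm (A *m x) | x in [set x : 'cV[R]_l | l2norm x <= 1]].

(* The library norm [`|x|] on matrices is the maximum of the absolute values
   of the entries; on column vectors it is the l_oo norm. *)
Definition linf_opnorm (R : realType) (k l : nat) (A : 'M[R]_(k, l)) : R :=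
  sup [set `| A *m x | | x in [set x : 'cV[R]_l | `| x | <= 1]].

Definition penrose (R : realType) (k l : nat)
    (A : 'M[R]_(k, l)) (X : 'M[R]_(l, k)) : Prop :=
  [/\ A *m X *m A = A, X *m A *m X = X,
      (A *m X)^T = A *m X & (X *m A)^T = X *m A].

(* Moore-Penrose pseudoinverse, not to be confused with [pinvmx], which is an
   arbitrary generalized inverse. *)
Definition mp_inv (R : realType) (k l : nat) (A : 'M[R]_(k, l)) :
  'M[R]_(l, k) := xget 0 [set X | penrose A X].

Lemma gram_unitmx (R : realType) (k l : nat) (A : 'M[R]_(k, l)) :
  row_free A -> A *m A^T \in unitmx.
Proof.
move=> fA; rewrite -row_free_unit -kermx_eq0; apply/rowV0P => x /sub_kermxP.
move=> xAA; apply: (row_free_inj fA); rewrite mul0mx.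
have := congr1 (fun M => (M *m x^T) 0 0) xAA.
rewrite mul0mx mulmxA -mulmxA -trmx_mul !mxE => /eqP.
rewrite psumr_eq0 => [/allP z|i _]; last first.
  by rewrite [X in _ * X]mxE -expr2 sqr_ge0.
apply/rowP => i; have := z i (mem_index_enum _).
by rewrite [X in _ * X]mxE -expr2 sqrf_eq0 mxE => /eqP ->; rewrite mxE.
Qed.

Lemma mp_invP (R : realType) (k l : nat) (A : 'M[R]_(k, l)) :
  penrose A (mp_inv A).
Proof.
suff [X hX] : exists X, penrose A X by rewrite /mp_inv; exact: (xgetI 0 hX).
have [r [G [F [-> fF fG]]]] : exists r (G : 'M[R]_(k, r)) (F : 'M[R]_(r, l)),
    [/\ A = G *m F, row_free F & row_free G^T].
  exists (\rank A), (col_base A), (row_base A).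
  rewrite mulmx_base row_base_free; split=> //.
  by rewrite /row_free mxrank_tr; exact: col_base_full.
have uF : F *m F^T \in unitmx by exact: gram_unitmx.
have uG : G^T *m G \in unitmx by rewrite -{2}[G]trmxK; exact: gram_unitmx.
pose W := F^T *m invmx (F *m F^T) *m invmx (G^T *m G) *m G^T.
have AW : G *m F *m W = G *m invmx (G^T *m G) *m G^T.
  by rewrite /W !mulmxA -(mulmxA G F) mulmxK.
have WA : W *m (G *m F) = F^T *m invmx (F *m F^T) *m F.
  by rewrite /W !mulmxA -(mulmxA _ G^T G) mulmxKV.
exists W; split.
- by rewrite AW !mulmxA -(mulmxA _ G^T G) mulmxKV.
- by rewrite WA /W !mulmxA -(mulmxA _ F F^T) mulmxKV.
- by rewrite AW !trmx_mul trmx_inv trmx_mul !trmxK mulmxA.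
- by rewrite WA !trmx_mul trmx_inv trmx_mul !trmxK mulmxA.
Qed.

Lemma penrose_uniq (R : realType) (k l : nat) (A : 'M[R]_(k, l)) X Y :
  penrose A X -> penrose A Y -> X = Y.
Proof.
move=> [x1 x2 x3 x4] [y1 y2 y3 y4].
have AXY : A *m X = A *m Y.
  by rewrite -x3 -{1}y1 -mulmxA trmx_mul x3 y3 mulmxA x1.
have XAY : X *m A = Y *m A.
  by rewrite -x4 -{1}y1 -mulmxA mulmxA trmx_mul x4 y4 -mulmxA (mulmxA A) x1.
by rewrite -x2 XAY -mulmxA AXY mulmxA y2.
Qed.

(* Stacked objects are indexed through [\mxcol], [\mxrow] and [\mxblock]: a
   vector of q blocks of height r has dimension [\sum_(k < q) r] = q * r. *)

Definition obs_mx (R : realType) (n p : nat) (A : 'M[R]_n) (C : 'M[R]_(p, n))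
    (q : nat) : 'M[R]_(\sum_(a < q) p, n) :=
  \mxcol_(a < q) (C *m A ^+ a).

Definition markov (R : realType) (n p r : nat) (A : 'M[R]_n)
    (C : 'M[R]_(p, n)) (D : 'M[R]_(n, r)) (l : nat) : 'M[R]_(p, r) :=
  if l is l'.+1 then C *m A ^+ l' *m D else 0.

(* Columns of B indexed by Q, in increasing order. *)
Definition colset (R : realType) (n m : nat) (B : 'M[R]_(n, m))
    (Q : {set 'I_m}) : 'M[R]_(n, #|Q|) :=
  colsub (@enum_val _ (mem Q)) B.

(* Block lower triangular Toeplitz matrix with q block rows and columns: the
   matrix J_{Q,[k:0]} is [toep_mx A B C Q k.+1], and J_{Q,[-1:0]} is
   [toep_mx A B C Q 0]. *)
Definition toep_mx (R : realType) (n m p : nat) (A : 'M[R]_n)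
    (B : 'M[R]_(n, m)) (C : 'M[R]_(p, n)) (Q : {set 'I_m}) (q : nat) :
    'M[R]_(\sum_(a < q) p, \sum_(b < q) #|Q|) :=
  \mxblock_(a < q, b < q)
    (if (b <= a)%N then markov A C (colset B Q) (a - b)%N else 0).

(* J_j, with blocks of width 1 and columns directly indexed by time. *)
Definition input_mx (R : realType) (n m p N : nat) (A : 'M[R]_n)
    (B : 'M[R]_(n, m)) (C : 'M[R]_(p, n)) (j : 'I_m) :
    'M[R]_(\sum_(a < N.+1) p, N.+1) :=
  \mxcol_(a < N.+1) \matrix_(i < p, b < N.+1)
    (if (b <= a)%N then markov A C (col j B) (a - b)%N i 0 else 0).

(* M_i^(Q): the block columns of J_Q are numbered from N (leftmost) down to
   0 (rightmost). *)
Definition blockcol (R : realType) (n m p N : nat) (A : 'M[R]_n)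
    (B : 'M[R]_(n, m)) (C : 'M[R]_(p, n)) (Q : {set 'I_m}) (i : nat) :
    'M[R]_(\sum_(a < N.+1) p, #|Q|) :=
  submxrow (toep_mx A B C Q N.+1) (inord (N - i)%N).

Definition Psi (R : realType) (n m p N : nat) (A : 'M[R]_n)
    (B : 'M[R]_(n, m)) (C : 'M[R]_(p, n)) (Q : {set 'I_m}) :
    'M[R]_(\sum_(a < N.+1) p, n + \sum_(b < N.+1) #|Q|) :=
  row_mx (obs_mx A C N.+1) (toep_mx A B C Q N.+1).

(* Psi_{Q,[N:d]} = [O M_N ... M_d]; meant for d <= N. *)
Definition Psi_left (R : realType) (n m p N : nat) (A : 'M[R]_n)
    (B : 'M[R]_(n, m)) (C : 'M[R]_(p, n)) (Q : {set 'I_m}) (d : nat) :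
    'M[R]_(\sum_(a < N.+1) p, n + \sum_(b < (N - d).+1) #|Q|) :=
  row_mx (obs_mx A C N.+1)
         (\mxrow_(b < (N - d).+1) blockcol N A B C Q (N - b)%N).

(* Psi_{Q,[d-1:0]} = [M_(d-1) ... M_0]. *)
Definition Psi_right (R : realType) (n m p N : nat) (A : 'M[R]_n)
    (B : 'M[R]_(n, m)) (C : 'M[R]_(p, n)) (Q : {set 'I_m}) (d : nat) :
    'M[R]_(\sum_(a < N.+1) p, \sum_(b < d) #|Q|) :=
  \mxrow_(b < d) blockcol N A B C Q (d - 1 - b)%N.

(* Pi~_{Q,[0:N-d]} = [I_(n+t) 0] with t = (N-d+1)|Q|. *)
Definition Pi_tilde (R : realType) (n m N : nat) (Q : {set 'I_m}) (d : nat) :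
    'M[R]_(n + \sum_(b < (N - d).+1) #|Q|, n + \sum_(b < N.+1) #|Q|) :=
  pid_mx (n + \sum_(b < (N - d).+1) #|Q|)%N.

(* Pi_{Q,[0:N-d]} = [0 I_t 0]. *)
Definition Pi_input (R : realType) (n m N : nat) (Q : {set 'I_m}) (d : nat) :
    'M[R]_(\sum_(b < (N - d).+1) #|Q|, n + \sum_(b < N.+1) #|Q|) :=
  row_mx 0 (pid_mx (\sum_(b < (N - d).+1) #|Q|)%N).

Definition is_least (P : nat -> Prop) (d : nat) : Prop :=
  P d /\ forall d', P d' -> (d <= d')%N.

(* [is_eta A B C Q d] means that eta_Q is finite and equal to d. *)
Definition is_eta (R : realType) (n m p : nat) (A : 'M[R]_n)
    (B : 'M[R]_(n, m)) (C : 'M[R]_(p, n)) (Q : {set 'I_m}) : nat -> Prop :=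
  is_least (fun d =>
    (\rank (toep_mx A B C Q d.+1) - \rank (toep_mx A B C Q d))%N = #|Q|).

(* [is_mu A B C Q d] means that mu_Q is finite and equal to d. *)
Definition is_mu (R : realType) (n m p : nat) (A : 'M[R]_n)
    (B : 'M[R]_(n, m)) (C : 'M[R]_(p, n)) (Q : {set 'I_m}) : nat -> Prop :=
  is_least (fun d =>
    (\rank (row_mx (obs_mx A C d.+1) (toep_mx A B C Q d.+1))
     - \rank (toep_mx A B C Q d.+1))%N = n).

Definition active (R : realType) (m N : nat) (u : 'I_m -> 'cV[R]_N.+1) :
  {set 'I_m} := finset (fun j => u j != 0).

(* w_{[0:N-d]} *)
Definition trunc (R : realType) (N d : nat) (w : 'cV[R]_N.+1) :
  'cV[R]_(N - d).+1 := \col_(k < (N - d).+1) w (inord k) 0.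

(* beta_{Q,[0:N-d]}: x0, u_Q[0], ..., u_Q[N-d] stacked. It is defined for every
   index set Q so that it can be compared with an estimate supported on a
   data-dependent set equal to the active set, without a dimension cast. *)
Definition stacked (R : realType) (n m N : nat) (x0 : 'cV[R]_n)
    (u : 'I_m -> 'cV[R]_N.+1) (Q : {set 'I_m}) (d : nat) :
    'cV[R]_(n + \sum_(k < (N - d).+1) #|Q|) :=
  col_mx x0 (\mxcol_(k < (N - d).+1)
    \col_(i < #|Q|) u (enum_val i) (inord k) 0).

Definition noiseless (R : realType) (n m p N : nat) (A : 'M[R]_n)
    (B : 'M[R]_(n, m)) (C : 'M[R]_(p, n))
    (x : 'cV[R]_n) (u : 'I_m -> 'cV[R]_N.+1) :
    'cV[R]_(\sum_(a < N.+1) p) :=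
  obs_mx A C N.+1 *m x + \sum_(j < m) input_mx N A B C j *m u j.

Definition lasso_obj (R : realType) (n m p N : nat) (A : 'M[R]_n)
    (B : 'M[R]_(n, m)) (C : 'M[R]_(p, n)) (lambda : R)
    (y : 'cV[R]_(\sum_(a < N.+1) p))
    (x : 'cV[R]_n) (u : 'I_m -> 'cV[R]_N.+1) : R :=
  1 / (2 * (p * N.+1)%:R) * l2norm (y - noiseless A B C x u) ^+ 2
  + lambda * \sum_(j < m) l2norm (u j).

Definition lasso_opt (R : realType) (n m p N : nat) (A : 'M[R]_n)
    (B : 'M[R]_(n, m)) (C : 'M[R]_(p, n)) (lambda : R)
    (y : 'cV[R]_(\sum_(a < N.+1) p))
    (x : 'cV[R]_n) (u : 'I_m -> 'cV[R]_N.+1) : Prop :=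
  forall (x' : 'cV[R]_n) (u' : 'I_m -> 'cV[R]_N.+1),
    lasso_obj A B C lambda y x u <= lasso_obj A B C lambda y x' u'.

Definition ols (R : realType) (n m p N : nat) (A : 'M[R]_n)
    (B : 'M[R]_(n, m)) (C : 'M[R]_(p, n)) (Q : {set 'I_m}) (d : nat)
    (y : 'cV[R]_(\sum_(a < N.+1) p)) :
    'cV[R]_(n + \sum_(b < (N - d).+1) #|Q|) :=
  Pi_tilde R n N Q d *m (mp_inv (Psi N A B C Q) *m y).

(* Product rule for the full (finite) family; the rule for a subfamily is the
   case [F i = setT] outside of it. *)
Definition mutually_independent (R : realType) (disp : measure_display)
    (Omega : measurableType disp) (P : probability Omega R) (k : nat)
    (v : 'I_k -> {RV P >-> R}) : Prop :=
  forall F : 'I_k -> set R, (forall i, measurable (F i)) ->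
    P (\bigcap_i (v i @^-1` F i)) = (\prod_(i < k) P (v i @^-1` F i))%E.

(* The random vector (v_i)_i has law N(0, sigma^2 I_k); the second argument of
   [normal_prob] is the standard deviation. *)
Definition isotropic_gaussian (R : realType) (disp : measure_display)
    (Omega : measurableType disp) (P : probability Omega R) (k : nat)
    (v : 'I_k -> {RV P >-> R}) (sigma : R) : Prop :=
  mutually_independent v /\
  forall i (F : set R), measurable F ->
    P (v i @^-1` F) = normal_prob 0 sigma F.

(* Main.v *)
(* Let X = [O J_S], and let r be the residual of a lasso optimum.

   No false inclusion: since X^T r is known from the optimality conditions, r
   is the sum of P(v - sum_(j notin S) J_j u_j), with P the projection
   orthogonal to the range of X, and of X (X^T X)^+ X^T r.  Pairing r with
   sum_(j notin S) J_j u_j gives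
     T lambda sum |u_j|
       <= sum |u_j| (|J_j^T P v| + alpha T lambda) - |P sum J_j u_j|^2,
   hence u_j = 0 off S as soon as |J_j^T P v| < T lambda (1 - alpha).  This
   works for every optimum, without a dual certificate or uniqueness.

   No false exclusion and the OLS bound: the finite delays make the first
   n + t_S coordinates of a vector a function of its image by X, although X
   may be rank deficient.  With Pi these coordinates, Pi X^+ X = Pi and
   (Pi X^+)(Pi X^+)^T = (Psi_1^T M Psi_1)^+, so that A2 bounds the
   covariance of the estimation error Pi X^+ v.

   Each bound on v follows from finitely many half-space constraints, and the
   Gaussian moment generating function controls the failure of each of these. *)

Require Import Defs.
From HB Require Import structures.
From mathcomp Require Import all_boot all_order all_algebra.
From mathcomp Require Import all_classical all_reals all_analysis.
From mathcomp Require Import measurable_realfun.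
From mathcomp Require Import zify ring lra.
Import Order.TTheory GRing.Theory Num.Theory.
Import numFieldNormedType.Exports.
Set Implicit Arguments.
Unset Strict Implicit.
Unset Printing Implicit Defensive.
Local Open Scope classical_set_scope.
Local Open Scope ring_scope.

(** * Euclidean norms *)

Definition dot (R : realType) (k : nat) (x y : 'cV[R]_k) : R :=
  \sum_i x i 0 * y i 0.

Section dot_theory.
Context (R : realType).
Implicit Types k l : nat.

Lemma dotC k (x y : 'cV[R]_k) : dot x y = dot y x.
Proof. by apply: eq_bigr => i _; rewrite mulrC. Qed.

Lemma dotDl k (x y z : 'cV[R]_k) : dot (x + y) z = dot x z + dot y z.
Proof. by rewrite -big_split; apply: eq_bigr => i _; rewrite mxE mulrDl. Qed.

Lemma dotZl k a (x y : 'cV[R]_k) : dot (a *: x) y = a * dot x y.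
Proof. by rewrite mulr_sumr; apply: eq_bigr => i _; rewrite mxE mulrA. Qed.

Lemma dotNl k (x y : 'cV[R]_k) : dot (- x) y = - dot x y.
Proof. by rewrite -scaleN1r dotZl mulN1r. Qed.

Lemma dotBl k (x y z : 'cV[R]_k) : dot (x - y) z = dot x z - dot y z.
Proof. by rewrite dotDl dotNl. Qed.

Lemma dot0l k (x : 'cV[R]_k) : dot 0 x = 0.
Proof. by rewrite /dot big1// => i _; rewrite mxE mul0r. Qed.

Lemma dotDr k (x y z : 'cV[R]_k) : dot x (y + z) = dot x y + dot x z.
Proof. by rewrite dotC dotDl !(dotC x). Qed.

Lemma dotZr k a (x y : 'cV[R]_k) : dot x (a *: y) = a * dot x y.
Proof. by rewrite dotC dotZl dotC. Qed.

Lemma dotNr k (x y : 'cV[R]_k) : dot x (- y) = - dot x y.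
Proof. by rewrite dotC dotNl dotC. Qed.

Lemma dotBr k (x y z : 'cV[R]_k) : dot x (y - z) = dot x y - dot x z.
Proof. by rewrite dotDr dotNr. Qed.

Lemma dot0r k (x : 'cV[R]_k) : dot x 0 = 0.
Proof. by rewrite dotC dot0l. Qed.

Lemma dot_suml k (I : finType) (p : pred I) (f : I -> 'cV[R]_k) x :
  dot (\sum_(i | p i) f i) x = \sum_(i | p i) dot (f i) x.
Proof.
by apply: (big_morph (fun u => dot u x)) => [u w|]; rewrite ?dotDl ?dot0l.
Qed.

Lemma dotE k (x y : 'cV[R]_k) : dot x y = (x^T *m y) 0 0.
Proof. by rewrite mxE; apply: eq_bigr => i _; rewrite mxE. Qed.

Lemma dot_mulmxl k l (A : 'M[R]_(k, l)) x y : dot (A *m x) y = dot x (A^T *m y).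
Proof. by rewrite !dotE trmx_mul mulmxA. Qed.

Lemma dot_delta k (i : 'I_k) (x : 'cV[R]_k) : dot (delta_mx i 0) x = x i 0.
Proof.
rewrite /dot (bigD1 i)//= big1 => [|j ji]; rewrite !mxE ?eqxx ?mul1r ?addr0//.
by rewrite (negbTE ji) mul0r.
Qed.

Lemma dot_sqr_ge0 k (x : 'cV[R]_k) : 0 <= dot x x.
Proof. by apply: sumr_ge0 => i _; rewrite -expr2 sqr_ge0. Qed.

Lemma sqr_l2norm k (x : 'cV[R]_k) : l2norm x ^+ 2 = dot x x.
Proof.
rewrite sqr_sqrtr; first by apply: eq_bigr => i _; rewrite expr2.
by apply: sumr_ge0 => i _; rewrite sqr_ge0.
Qed.

Lemma l2norm_ge0 k (x : 'cV[R]_k) : 0 <= l2norm x.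
Proof. exact: sqrtr_ge0. Qed.

Lemma dot_eq0 k (x : 'cV[R]_k) : dot x x = 0 -> x = 0.
Proof.
move/eqP; rewrite psumr_eq0 => [/allP h|i _]; last by rewrite -expr2 sqr_ge0.
apply/colP => i; have := h i (mem_index_enum _).
by rewrite -expr2 sqrf_eq0 mxE => /eqP.
Qed.

Lemma l2norm_eq0 k (x : 'cV[R]_k) : l2norm x = 0 -> x = 0.
Proof. by move=> h; apply: dot_eq0; rewrite -sqr_l2norm h expr0n. Qed.

Lemma l2norm0 k : l2norm (0 : 'cV[R]_k) = 0.
Proof. by apply/eqP; rewrite -sqrf_eq0 sqr_l2norm dot0l. Qed.

Lemma l2norm_gt0 k (x : 'cV[R]_k) : x != 0 -> 0 < l2norm x.
Proof.
move=> x0; rewrite lt_neqAle l2norm_ge0 andbT eq_sym.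
by apply: contra x0 => /eqP /l2norm_eq0 ->.
Qed.

Lemma l2norm_le k (x : 'cV[R]_k) a : 0 <= a -> (l2norm x <= a) = (dot x x <= a ^+ 2).
Proof. by move=> a0; rewrite -sqr_l2norm ler_sqr// nnegrE l2norm_ge0. Qed.

Lemma l2norm_entry k (x : 'cV[R]_k) i : `|x i 0| <= l2norm x.
Proof.
rewrite -(ler_pXn2r (n:=2))// ?nnegrE ?l2norm_ge0// sqr_l2norm.
rewrite real_normK ?num_real// /dot (bigD1 i)//= -expr2 lerDl.
by apply: sumr_ge0 => j _; rewrite -expr2 sqr_ge0.
Qed.

Lemma l2normZ k a (x : 'cV[R]_k) : l2norm (a *: x) = `|a| * l2norm x.
Proof.
apply/eqP; rewrite -(eqrXn2 (n:=2))// ?mulr_ge0 ?l2norm_ge0//.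
by rewrite exprMn !sqr_l2norm dotZl dotZr mulrA real_normK ?num_real.
Qed.

Lemma l2normN k (x : 'cV[R]_k) : l2norm (- x) = l2norm x.
Proof. by rewrite -scaleN1r l2normZ normrN1 mul1r. Qed.

Lemma cauchy_schwarz k (x y : 'cV[R]_k) : dot x y <= l2norm x * l2norm y.
Proof.
have [->|/l2norm_gt0 y0] := eqVneq y 0; first by rewrite dot0r l2norm0 mulr0.
have := dot_sqr_ge0 (l2norm y ^+ 2 *: x - dot x y *: y).
rewrite !(dotBl, dotBr, dotZl, dotZr) (dotC y x) -!sqr_l2norm.
set a := l2norm x; set b := l2norm y; set c := dot x y => h.
have : 0 <= b ^+ 2 * ((a * b) ^+ 2 - c ^+ 2) by apply: le_trans h _; lra.
rewrite pmulr_rge0 ?exprn_gt0// subr_ge0 => {}h.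
have ab : 0 <= a * b by rewrite mulr_ge0 ?l2norm_ge0.
apply: le_trans (ler_norm c) _.
by rewrite -(ler_pXn2r (n:=2))// ?nnegrE// real_normK ?num_real.
Qed.

Lemma l2normD k (x y : 'cV[R]_k) : l2norm (x + y) <= l2norm x + l2norm y.
Proof.
rewrite l2norm_le ?addr_ge0 ?l2norm_ge0// !(dotDl, dotDr) (dotC y x) -!sqr_l2norm.
have := cauchy_schwarz x y; lra.
Qed.

(** The Frobenius norm bounds the image of the unit ball, so the [sup] in [l2_opnorm] is taken over
    a bounded set. *)
Lemma mulmx_l2norm_bound k l (A : 'M[R]_(k, l)) x :
  l2norm (A *m x) <= Num.sqrt (\sum_i \sum_j A i j ^+ 2) * l2norm x.
Proof.
have s0 : 0 <= \sum_i \sum_j A i j ^+ 2.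
  by do 2 (apply: sumr_ge0 => ? _); rewrite sqr_ge0.
rewrite l2norm_le ?mulr_ge0 ?sqrtr_ge0 ?l2norm_ge0// exprMn sqr_sqrtr// mulr_suml.
apply: ler_sum => i _.
have -> : (A *m x) i 0 = dot (row i A)^T x.
  by rewrite mxE; apply: eq_bigr => j _; rewrite !mxE.
have -> : \sum_j A i j ^+ 2 = l2norm (row i A)^T ^+ 2.
  by rewrite sqr_l2norm; apply: eq_bigr => j _; rewrite !mxE expr2.
rewrite -expr2 -exprMn -(real_normK (num_real (dot _ _))) ler_pXn2r ?nnegrE ?mulr_ge0 ?l2norm_ge0//.
rewrite ler_norml cauchy_schwarz andbT lerNl -dotNl.
by rewrite (le_trans (cauchy_schwarz _ _))// l2normN.
Qed.

Lemma l2_opnormP k l (A : 'M[R]_(k, l)) x :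
  l2norm (A *m x) <= l2_opnorm A * l2norm x.
Proof.
have [->|x0] := eqVneq x 0; first by rewrite mulmx0 !l2norm0 mulr0.
have x1 := l2norm_gt0 x0.
rewrite -ler_pdivrMr//.
have -> : l2norm (A *m x) / l2norm x = l2norm (A *m ((l2norm x)^-1 *: x)).
  by rewrite -scalemxAr l2normZ ger0_norm ?invr_ge0 ?l2norm_ge0// mulrC.
apply: ub_le_sup; last first.
  exists ((l2norm x)^-1 *: x) => //=.
  by rewrite l2normZ ger0_norm ?invr_ge0 ?l2norm_ge0// mulVf// gt_eqF.
exists (Num.sqrt (\sum_i \sum_j A i j ^+ 2)) => _ [y /= y1 <-].
apply: le_trans (mulmx_l2norm_bound _ _) _.
by rewrite ler_piMr ?sqrtr_ge0.
Qed.

Lemma l2_opnorm_ge0 k l (A : 'M[R]_(k, l)) : 0 <= l2_opnorm A.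
Proof.
apply: le_trans (l2norm_ge0 (A *m (0 : 'cV[R]_l))) _.
apply: ub_le_sup; last by exists (0 : 'cV[R]_l) => //=; rewrite l2norm0.
exists (Num.sqrt (\sum_i \sum_j A i j ^+ 2)) => _ [y /= y1 <-].
apply: le_trans (mulmx_l2norm_bound _ _) _.
by rewrite ler_piMr ?sqrtr_ge0.
Qed.

Lemma mx_norm_entry k (x : 'cV[R]_k) i : `|x i 0| <= `|x|.
Proof.
rewrite [leRHS]/Num.norm/= mx_normrE.
exact: (le_bigmax 0 (fun ij : 'I_k * 'I_1 => `|x ij.1 ij.2|) (i, 0)).
Qed.

Lemma mx_norm_le k (x : 'cV[R]_k) a :
  0 <= a -> (forall i, `|x i 0| <= a) -> `|x| <= a.
Proof.
move=> a0 h; rewrite [leLHS]/Num.norm/= mx_normrE.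
by apply: bigmax_le => // -[i j] _ /=; rewrite ord1.
Qed.

Lemma linf_opnormP k l (A : 'M[R]_(k, l)) (x : 'cV[R]_l) :
  `|x| <= 1 -> `|A *m x| <= linf_opnorm A.
Proof.
move=> x1; apply: ub_le_sup; last by exists x.
have s0 : 0 <= \sum_i \sum_j `|A i j| by do 2 (apply: sumr_ge0 => ? _).
exists (\sum_i \sum_j `|A i j|) => _ [y /= y1 <-].
apply: mx_norm_le => // i; rewrite mxE (bigD1 i)//=.
apply: le_trans (ler_norm_sum _ _ _) _.
rewrite -[leLHS]addr0; apply: lerD; last first.
  by do 2 (apply: sumr_ge0 => ? _).
apply: ler_sum => j _; rewrite normrM ler_piMr//.
by rewrite (le_trans (mx_norm_entry _ _)).
Qed.

End dot_theory.

(** * Gaussian half-spaces *)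

Section change_of_variables.
Context d1 d2 (X : measurableType d1) (Y : measurableType d2) (R : realType).
Variables (mu : {measure set X -> \bar R}) (nu : {measure set Y -> \bar R}).
Variables (Z : X -> Y) (g : X -> R) (c : R).
Hypotheses (mZ : measurable_fun setT Z) (mg : measurable_fun setT g).
Hypothesis g0 : forall x, 0 <= g x.
Hypothesis gZ : forall F : set Y, measurable F ->
  (\int[mu]_x (g x * \1_F (Z x))%:E = c%:E * nu F)%E.

Import HBNNSimple.

(** [gZ] is the case of indicators; linearity over level sets gives simple functions, and monotone
    convergence the rest. It serves both to integrate out one independent factor and to integrate
    against the normal density. *)
Lemma ge0_integral_weighted_pushforward (f : Y -> R) :
  measurable_fun setT f -> (forall y, 0 <= f y) ->
  (\int[mu]_x (g x * f (Z x))%:E = c%:E * \int[nu]_y (f y)%:E)%E.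
Proof.
move=> mf f0.
have mf' : measurable_fun setT (EFin \o f) by exact/measurable_EFinP.
pose h := nnsfun_approx measurableT mf'.
have hf y : (h n y)%:E @[n --> \oo] --> (f y)%:E.
  by apply: (@cvg_nnsfun_approx _ _ _ _ measurableT _ mf') => //= z _; rewrite lee_fin.
have hnd y : {homo (fun n => h n y) : a b / (a <= b)%N >-> a <= b}.
  by move=> a b ab; exact/lefP/nd_nnsfun_approx.
have mhZ n : measurable_fun setT (fun x => g x * h n (Z x)).
  by apply: measurable_funM => //; apply: measurableT_comp.
have -> : (\int[nu]_y (f y)%:E = lim (\int[nu]_y (h n y)%:E @[n --> \oo]))%E.
  rewrite -monotone_convergence//.
  - by apply: eq_integral => y _; apply/esym/cvg_lim => //; exact: hf.
  - by move=> n; exact/measurable_EFinP.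
  - by move=> n y _; rewrite lee_fin.
  - by move=> y _ a b ab; rewrite lee_fin; exact: hnd.
have -> : (\int[mu]_x (g x * f (Z x))%:E =
    lim (\int[mu]_x (g x * h n (Z x))%:E @[n --> \oo]))%E.
  rewrite -monotone_convergence//.
  - apply: eq_integral => x _; apply/esym/cvg_lim => //.
    under eq_fun do rewrite EFinM.
    by rewrite EFinM; apply: cvgeZl => //; exact: hf.
  - by move=> n; exact/measurable_EFinP.
  - by move=> n y _; rewrite lee_fin mulr_ge0.
  - by move=> y _ a b ab; rewrite lee_fin ler_wpM2l//; exact: hnd.
have step n : (\int[mu]_x (g x * h n (Z x))%:E = c%:E * \int[nu]_y (h n y)%:E)%E.
  have mI k : measurable_fun setT (fun x => g x * (k * \1_(h n @^-1` [set k]) (Z x))).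
    apply: measurable_funM => //; apply: measurable_funM => //.
    by apply: measurableT_comp.
  transitivity (\sum_(k \in range (h n))
      \int[mu]_x (g x * (k * \1_(h n @^-1` [set k]) (Z x)))%:E)%E.
    rewrite -ge0_integral_fsum//.
    - apply: eq_integral => x _; rewrite fsumEFin//; congr EFin.
      by rewrite (fimfunE (h n)) mulr_fsumr.
    - by move=> k; exact/measurable_EFinP.
    - move=> k x _; rewrite lee_fin mulr_ge0//.
      exact: (nnfun_muleindic_ge0 (h n)).
  transitivity (c%:E * \sum_(k \in range (h n))
      \int[nu]_y (k * \1_(h n @^-1` [set k]) y)%:E)%E; last first.
    congr (_ * _)%E; rewrite -ge0_integral_fsum//.
    - by apply: eq_integral => y _; rewrite fsumEFin//; congr EFin; rewrite (fimfunE (h n)).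
    - by move=> k; exact/measurable_EFinP/measurable_funM.
    - by move=> k x _; exact: nnfun_muleindic_ge0.
  rewrite ge0_mule_fsumr; last first.
    by move=> k; apply: integral_ge0 => y _; exact: nnfun_muleindic_ge0.
  apply: eq_fsbigr => k /[!inE] -[y0 _ <-]; set r := h n y0.
  have r0 : 0 <= r by [].
  have mr : measurable (h n @^-1` [set r]) by exact: measurable_sfunP.
  under eq_integral do rewrite mulrCA EFinM.
  rewrite ge0_integralZl//; last 2 first.
    apply/measurable_EFinP; apply: measurable_funM => //.
      by apply: measurableT_comp.
    by move=> x _; rewrite lee_fin mulr_ge0.
  rewrite gZ//.
  under [in RHS]eq_integral do rewrite EFinM.
  rewrite ge0_integralZl//; last exact/measurable_EFinP.
  by rewrite integral_indic// setIT muleCA.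
under eq_fun do rewrite step.
apply/cvg_lim => //.
apply: cvgeZl => //.
apply: cvgP.
apply: ereal_nondecreasing_cvgn => a b ab; apply: ge0_le_integral => //.
- by move=> x _; rewrite lee_fin.
- exact/measurable_EFinP.
- exact/measurable_EFinP.
- by move=> x _; rewrite lee_fin; exact: hnd.
Qed.

End change_of_variables.

(* The indicator functions given by independence are replaced by the [f i] one
   index at a time. *)
Lemma integral_prod_independent (R : realType) (disp : measure_display)
    (Omega : measurableType disp) (P : probability Omega R)
    (nu : {measure set (measurableTypeR R) -> \bar R}) (k : nat) (v : 'I_k -> {RV P >-> R})
    (f : 'I_k -> R -> R) (M : 'I_k -> R) :
  mutually_independent v ->
  (forall i (F : set R), measurable F -> P (v i @^-1` F) = nu F) ->
  (forall i, measurable_fun setT (f i)) -> (forall i y, 0 <= f i y) ->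
  (forall i, (\int[nu]_y (f i y)%:E = (M i)%:E)%E) ->
  (\int[P]_w (\prod_i f i (v i w))%:E = (\prod_i M i)%:E)%E.
Proof.
move=> indep law mf f0 fM.
have M0 i : 0 <= M i by rewrite -lee_fin -fM; apply: integral_ge0 => y _; rewrite lee_fin.
have nuF (i : 'I_k) (F : set R) : measurable F -> (nu F = (fine (nu F))%:E)%E.
  move=> mF; rewrite fineK// -(law i)//.
  apply: fin_num_measure.
  exact: measurable_funPTI.
pose h (A : {set 'I_k}) (F : 'I_k -> set R) i : R -> R :=
  if i \in A then f i else \1_(F i).
pose Mh (A : {set 'I_k}) (F : 'I_k -> set R) i :=
  if i \in A then M i else fine (nu (F i)).
suff H : forall A F, (forall i, measurable (F i)) ->
    (\int[P]_w (\prod_i h A F i (v i w))%:E = (\prod_i Mh A F i)%:E)%E.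
  have := H [set: 'I_k]%SET (fun=> setT) (fun=> measurableT).
  rewrite [in RHS](eq_bigr M) => [<-|i _]; last by rewrite /Mh inE.
  apply: eq_integral => w _; congr EFin; apply: eq_bigr => i _.
  by rewrite /h inE.
move=> A F; have [s As] := ubnP #|A|.
elim: s => // s IH in A As F *.
have [->|/set0Pn[i0 i0A]] := eqVneq A finset.set0.
  move=> mF.
  have mcap : measurable (\bigcap_i (v i @^-1` F i)).
    apply: fin_bigcap_measurable => // i _.
    exact: measurable_funPTI.
  transitivity (\int[P]_w (\1_(\bigcap_i (v i @^-1` F i)) w)%:E)%E.
    apply: eq_integral => w _; congr EFin.
    rewrite indicE; have [H|H] := pselect ((\bigcap_i (v i @^-1` F i)) w).
      rewrite mem_set// big1// => i _.
      by rewrite /h inE indicE mem_set//; exact: H.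
    rewrite memNset//; have [i Hi] : exists i, ~ F i (v i w).
      by apply/not_existsP => H'; apply: H => i _; apply: contrapT; exact: H'.
    by rewrite (bigD1 i)//= /h inE indicE memNset// mul0r.
  rewrite integral_indic// setIT; apply: etrans (indep F mF) _; rewrite -prodEFin.
  by apply: eq_bigr => i _; rewrite /Mh inE law// nuF.
move=> mF.
pose g w := \prod_(i < k | i != i0) h A F i (v i w).
pose c := \prod_(i < k | i != i0) Mh A F i.
have mh B E i : (forall i, measurable (E i)) -> measurable_fun setT (h B E i).
  by move=> mE; rewrite /h; case: ifP.
have h0 B E i y : 0 <= h B E i y by rewrite /h; case: ifP.
have -> : \prod_i Mh A F i = c * M i0.
  by rewrite (bigD1 i0)//= mulrC; congr (_ * _); rewrite /Mh i0A.
rewrite EFinM -fM -(@ge0_integral_weighted_pushforward _ _ _ _ _ P nu (v i0) g).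
- apply: eq_integral => w _; congr EFin.
  by rewrite (bigD1 i0)//= mulrC; congr (_ * _); rewrite /h i0A.
- exact: (measurable_funPT (v i0)).
- rewrite /g; under eq_fun do rewrite -big_filter.
  apply: measurable_prod => i _.
  by apply: measurableT_comp => //; exact: mh.
- by move=> w; rewrite /g prodr_ge0.
(* The hypothesis on indicators is the induction hypothesis for [A] without [i0], with the event at
   [i0] set to [G]. *)
- move=> G mG; pose F' i : set R := if i == i0 then G else F i.
  have mF' i : measurable (F' i) by rewrite /F'; case: eqP.
  have -> : (c%:E * nu G = (\prod_i Mh (A :\ i0)%SET F' i)%:E)%E.
    rewrite (bigD1 i0)//= mulrC EFinM; congr (_ * _)%E.
      congr EFin; apply: eq_bigr => i ii0.
      by rewrite /Mh /F' in_setD1 ii0 (negbTE ii0).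
    by rewrite /Mh /F' in_setD1 eqxx /= -nuF.
  rewrite -IH//; last by move: As; rewrite (cardsD1 i0) i0A.
  apply: eq_integral => w _; congr EFin.
  rewrite [RHS](bigD1 i0)//= mulrC; congr (_ * _).
    by rewrite /h /F' in_setD1 eqxx.
  apply: eq_bigr => i ii0.
  by rewrite /h /F' in_setD1 ii0 (negbTE ii0).
- exact: mf.
- exact: f0.
Qed.

Lemma normal_mgf (R : realType) (sigma a : R) : sigma != 0 ->
  (\int[normal_prob 0 sigma]_y (expR (a * y))%:E =
   (expR (sigma ^+ 2 * a ^+ 2 / 2))%:E)%E.
Proof.
move=> s0.
have mexp : measurable_fun [set: R] (fun y => expR (a * y)).
  by apply: measurableT_comp => //; exact: measurable_funM.
have -> : (\int[normal_prob 0 sigma]_y (expR (a * y))%:E =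
    \int[lebesgue_measure]_y (normal_pdf 0 sigma y * expR (a * y))%:E)%E.
  have H (F : set R) : measurable F ->
      (\int[lebesgue_measure]_x (normal_pdf 0 sigma x * \1_F x)%:E =
       1%:E * normal_prob 0 sigma F)%E.
    move=> mF; rewrite mul1e /normal_prob [RHS]integral_mkcond.
    apply: eq_integral => x _; rewrite patchE indicE.
    by case: ifP; rewrite ?mulr1 ?mulr0.
  have := @ge0_integral_weighted_pushforward _ _ _ _ _ lebesgue_measure
    (normal_prob 0 sigma) id (normal_pdf 0 sigma) 1 (@measurable_id _ _ _)
    (measurable_normal_pdf 0 sigma) (normal_pdf_ge0 0 sigma) H
    (fun y => expR (a * y)) mexp (fun y => expR_ge0 _).
  by rewrite mul1e => ->.
(* Completing the square: tilting the centred density by [expR (a * y)] gives, up to a constant, the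
   density centred at [sigma ^+ 2 * a]. *)
transitivity (\int[lebesgue_measure]_y
    ((expR (sigma ^+ 2 * a ^+ 2 / 2))%:E * (normal_pdf (sigma ^+ 2 * a) sigma y)%:E))%E.
  apply: eq_integral => x _; rewrite -EFinM; congr EFin.
  rewrite /normal_pdf (negbTE s0) [RHS]mulrCA -[LHS]mulrA; congr (_ * _).
  rewrite /normal_fun -!expRD; congr expR.
  by field.
rewrite ge0_integralZl//.
- by rewrite integral_normal_pdf mule1.
- by apply/measurable_EFinP; exact: measurable_normal_pdf.
- by move=> x _; rewrite lee_fin normal_pdf_ge0.
Qed.

Section gaussian_halfspaces.
Context (R : realType) (disp : measure_display).
Context (Omega : measurableType disp) (P : probability Omega R).
Context (k : nat) (v : 'I_k -> {RV P >-> R}) (sigma : R).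
Hypotheses (s0 : 0 < sigma) (gv : isotropic_gaussian v sigma).

Let V w : 'cV[R]_k := \col_i v i w.

Lemma measurable_dot_gaussian a : measurable_fun setT (fun w => dot a (V w)).
Proof.
rewrite /dot; apply: measurable_sum => i.
apply: measurable_funM => //.
by apply: eq_measurable_fun (measurable_funPT (v i)) => w _; rewrite mxE.
Qed.

(** Chernoff's bound with exponential parameter 1: the indicator is at most
    [expR (dot a (V w) - b)], whose mean factorizes by independence. Any other parameter is obtained
    by scaling [a] and [b] together. *)
Lemma gaussian_halfspace a b :
  (P [set w | (b <= dot a (V w))%R] <=
   (expR (sigma ^+ 2 / 2 * l2norm a ^+ 2 - b))%:E)%E.
Proof.
have mS : measurable [set w | b <= dot a (V w)].
  rewrite -[X in measurable X]setTI.
  by apply: measurable_fun_le => //; exact: measurable_dot_gaussian.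
have me c : measurable_fun [set: R] (fun y => expR (c * y)).
  by apply: measurableT_comp => //; exact: measurable_funM.
have [indep law] := gv.
have H := @integral_prod_independent _ _ _ P (normal_prob 0 sigma) k v
  (fun i y => expR (a i 0 * y)) (fun i => expR (sigma ^+ 2 * a i 0 ^+ 2 / 2))
  indep law (fun i => me _) (fun i y => expR_ge0 _)
  (fun i => normal_mgf (a i 0) (lt0r_neq0 s0)).
rewrite -[X in P X]setIT -integral_indic//.
have -> : expR (sigma ^+ 2 / 2 * l2norm a ^+ 2 - b) =
    expR (- b) * \prod_i expR (sigma ^+ 2 * a i 0 ^+ 2 / 2).
  rewrite addrC expRD -expR_sum; congr (_ * expR _).
  rewrite sqr_sqrtr ?sumr_ge0// => [|i _]; last exact: sqr_ge0.
  by rewrite mulr_sumr; apply: eq_bigr => i _; rewrite mulrAC.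
have mp : measurable_fun setT (fun w => (\prod_i expR (a i 0 * v i w))).
  apply: measurable_prod => i _.
  by apply: (measurableT_comp (me _)).
rewrite EFinM -H -ge0_integralZl//; last 2 first.
- exact/measurable_EFinP.
- by move=> w _; rewrite lee_fin prodr_ge0// => i _; exact: expR_ge0.
apply: ge0_le_integral => //.
- exact/measurable_EFinP.
- by apply/measurable_EFinP/measurable_funM.
move=> w _; rewrite lee_fin -expR_sum -expRD indicE.
have -> : \sum_(i < k) a i 0 * v i w = dot a (V w).
  by apply: eq_bigr => i _; rewrite mxE.
have [/set_mem h|_] := boolP (_ \in _); last exact: expR_ge0.
by rewrite -expR0 ler_expR addrC subr_ge0.
Qed.

(** Union bound. Norm bounds are later deduced pointwise from the finitely many constraints in [L],
    so only half-spaces have to be measured. *)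
Lemma gaussian_halfspaces (L : seq ('cV[R]_k * R)) : exists B : set Omega,
  [/\ measurable B,
    (P B <= (\sum_(h <- L) expR (sigma ^+ 2 / 2 * l2norm h.1 ^+ 2 - h.2))%:E)%E &
    forall w, ~ B w -> forall h, h \in L -> dot h.1 (V w) < h.2].
Proof.
elim: L => [|[a b] L [B [mB PB hB]]].
  by exists set0; split => //; rewrite big_nil measure0.
pose S := [set w | b <= dot a (V w)].
have mS : measurable S.
  rewrite -[X in measurable X]setTI.
  by apply: measurable_fun_le => //; exact: measurable_dot_gaussian.
exists (S `|` B); split.
- exact: measurableU.
- rewrite big_cons EFinD; apply: le_trans (measureU2 _ mS mB) _.
  by apply: leeD => //; exact: gaussian_halfspace.
- move=> w /not_orP[nS nB] h; rewrite inE => /predU1P[->/=|]; last exact: hB.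
  by rewrite ltNge; apply/negP.
Qed.

End gaussian_halfspaces.

(** * Norm and entry bounds by half-spaces *)

(** Since [(i - 1)^2 >= 0], [i^2 / 4 >= i / 2 - 1 / 4]: the sum is compared with a geometric series
    of ratio [expR (- (1 / 2)) <= 2 / 3], whose sum is at most 3. The bound is uniform in [M]. *)
Lemma sum_expR_sqr_le (R : realType) (M : nat) :
  \sum_(i < M) expR (- (i%:R ^+ 2 / 4)) <= 3 * expR (1 / 4) :> R.
Proof.
have e1 : expR (- (1 / 2)) <= 2 / 3 :> R.
  have h : expR (- (1 / 2)) * expR (1 / 2) = 1 :> R by rewrite -expRD addNr expR0.
  have := expR_ge1Dx (1 / 2 : R); have := expR_gt0 (- (1 / 2) : R); nra.
have e0 : 0 <= expR (- (1 / 2)) :> R by exact: expR_ge0.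
apply: (@le_trans _ _ (\sum_(i < M) expR (- (1 / 2)) ^+ i * expR (1 / 4))).
  apply: ler_sum => i _; rewrite -expRM_natl -expRD ler_expR.
  have := sqr_ge0 (i%:R - 1 : R); rewrite -mulr_natl; lra.
rewrite -mulr_suml ler_wpM2r ?expR_ge0//.
have := subrX1 (expR (- (1 / 2)) : R) M.
set s := \sum_(i < M) _; set e := expR _ => h.
have s0 : 0 <= s by apply: sumr_ge0 => i _; rewrite exprn_ge0.
have eM : 0 <= e ^+ M by rewrite exprn_ge0.
have : s * (1 - e) <= 1 by lra.
have : 0 <= s * (2 / 3 - e) by rewrite mulr_ge0// subr_ge0.
lra.
Qed.

(** The 6 is the 3 of the previous bound times two signs. One lattice coordinate then costs
    [expR (7 / 2)]; with the [1 / 2] lost by truncation, the exponent is 4 per dimension. *)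
Lemma expR_quarter_le (R : realType) : 6 * expR (1 / 4) <= expR (7 / 2) :> R.
Proof.
have -> : 7 / 2 = 3 + 1 / 4 + 1 / 4 :> R by lra.
rewrite expRD; apply: ler_wpM2r; first exact: expR_ge0.
rewrite expRD; have h1 : 1 <= expR (1 / 4) :> R by apply: le_trans (expR_ge1Dx _); lra.
have h2 : 2 <= expR 1 :> R by apply: le_trans (expR_ge1Dx _); lra.
have h3 : expR 3 = expR 1 ^+ 3 :> R by rewrite -expRM_natl mulr1.
have : (2 : R) ^+ 3 <= expR 1 ^+ 3 by rewrite ler_pXn2r ?nnegrE.
rewrite -h3 => h4.
have : 2 ^+ 3 = 8 :> R by ring.
nra.
Qed.

Section net.
Context (R : realType) (q k : nat) (W : 'M[R]_(q, k)) (sigma tau s : R).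
Hypotheses (tau0 : 0 < tau) (s0 : 0 < s).
Hypothesis hW : forall h : 'cV[R]_q,
  sigma * l2norm (W^T *m h) <= tau * l2norm h.
Hypothesis sigma0 : 0 <= sigma.

(* If [s <= l2norm g] with [g := W *m x], rescale [g] to length [c * s] and
   truncate it to an integer vector [kv]; then [x] lies in the half-space
   attached to [kv].  The factor [expR (l2norm kv ^+ 2 / 2)] in the thresholds
   makes the sum over all the integer vectors converge, like a theta series. *)
Lemma lattice_halfspaces : exists L : seq ('cV[R]_k * R),
  \sum_(h <- L) expR (sigma ^+ 2 / 2 * l2norm h.1 ^+ 2 - h.2) <=
    expR (4 * q%:R - s ^+ 2 / (4 * tau ^+ 2)) /\
  forall x, (forall h, h \in L -> dot h.1 x < h.2) -> l2norm (W *m x) < s.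
Proof.
(* [c] is chosen so that [(c * tau) ^+ 2 = 1 / 2]: the variance term of a half-space is then at most
   [l2norm kv ^+ 2 / 4], half of what its threshold provides. *)
pose c : R := (Num.sqrt 2 * tau)^-1.
have t2 : 0 < Num.sqrt 2 * tau by rewrite mulr_gt0// sqrtr_gt0.
have c0 : 0 < c by rewrite invr_gt0.
have ct : (c * tau) ^+ 2 = 1 / 2.
  rewrite /c invfM -mulrA mulVf ?mulr1 ?gt_eqF// exprVn sqr_sqrtr//.
  by rewrite div1r.
(* The entries of a vector of length [c * s] truncate to integers below [M] in absolute value, so
   finitely many lattice vectors suffice. *)
pose M := (Num.truncn (c * s)).+1.
pose kv (f : {ffun 'I_q -> bool * 'I_M}) : 'cV[R]_q :=
  \col_i ((-1) ^+ (f i).1 * (f i).2%:R).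
pose hs f := (c *: (W^T *m kv f),
  (c * s) ^+ 2 / 2 - q%:R / 2 + l2norm (kv f) ^+ 2 / 2).
exists [seq hs f | f : {ffun 'I_q -> bool * 'I_M}]; split.
  rewrite big_image /=.
  have kvE f : l2norm (kv f) ^+ 2 = \sum_i (f i).2%:R ^+ 2.
    by rewrite sqr_l2norm; apply: eq_bigr => i _; rewrite mxE mulrACA -signr_addb addbb mul1r expr2.
  apply: (@le_trans _ _ (\sum_(f : {ffun 'I_q -> bool * 'I_M})
     expR (q%:R / 2 - (c * s) ^+ 2 / 2) * \prod_i expR (- ((f i).2%:R ^+ 2 / 4)))).
    apply: ler_sum => f _; rewrite -expR_sum -expRD ler_expR.
    rewrite sumrN -mulr_suml -kvE l2normZ (ger0_norm (ltW c0)) exprMn.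
    have : (c * (sigma * l2norm (W^T *m kv f))) ^+ 2 <= (c * (tau * l2norm (kv f))) ^+ 2.
      by rewrite ler_pXn2r ?nnegrE ?mulr_ge0 ?l2norm_ge0 ?(ltW c0) ?(ltW tau0)// ler_pM2l.
    rewrite [c * (tau * _)]mulrA [(c * tau * _) ^+ 2]exprMn ct.
    set a := l2norm _; set b := l2norm _ => h.
    have -> : sigma ^+ 2 / 2 * (c ^+ 2 * a ^+ 2) = (c * (sigma * a)) ^+ 2 / 2 by field.
    lra.
  rewrite -mulr_sumr -(bigA_distr_bigA (fun (_ : 'I_q) (j : (bool * 'I_M)%type) =>
    expR (- (j.2%:R ^+ 2 / 4)))) /=.
  rewrite prodr_const card_ord.
  have S1 : \sum_(j : bool * 'I_M) expR (- (j.2%:R ^+ 2 / 4)) <= expR (7 / 2) :> R.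
    apply: le_trans (expR_quarter_le R).
    rewrite -(pair_big xpredT xpredT (fun (_ : bool) (j : 'I_M) => expR (- (j%:R ^+ 2 / 4)))) /=.
    rewrite big_bool /=; have := sum_expR_sqr_le R M; lra.
  apply: (@le_trans _ _ (expR (q%:R / 2 - (c * s) ^+ 2 / 2) * expR (7 / 2) ^+ q)).
    rewrite ler_wpM2l ?expR_ge0// lerXn2r ?nnegrE ?expR_ge0//.
    by apply: sumr_ge0 => j _; rewrite expR_ge0.
  rewrite -expRM_natl -expRD ler_expR -mulr_natl.
  have -> : (c * s) ^+ 2 = s ^+ 2 / (2 * tau ^+ 2).
    have -> : (c * s) ^+ 2 = (c * tau) ^+ 2 * s ^+ 2 / tau ^+ 2.
      by field; rewrite gt_eqF.
    by rewrite ct; field; rewrite gt_eqF.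
  have -> : s ^+ 2 / (4 * tau ^+ 2) = s ^+ 2 / (2 * tau ^+ 2) / 2.
    by field; rewrite gt_eqF.
  lra.
move=> x hx; rewrite ltNge; apply/negP => sg.
set g := W *m x in sg.
have g0 : 0 < l2norm g by exact: lt_le_trans sg.
pose z : 'cV[R]_q := (c * s / l2norm g) *: g.
have a0 : 0 < c * s / l2norm g by rewrite !mulr_gt0 ?invr_gt0.
have zn : l2norm z = c * s.
  by rewrite l2normZ (ger0_norm (ltW a0)) mulfVK// gt_eqF.
have zi i : `|z i 0| <= c * s by rewrite -zn l2norm_entry.
have Mi i : (Num.truncn `|z i 0|%R < M)%N by rewrite ltnS le_truncn.
pose f : {ffun 'I_q -> bool * 'I_M} := [ffun i => (z i 0 < 0, Ordinal (Mi i))].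
have kz i : kv f i 0 * z i 0 = (Num.truncn `|z i 0|)%:R * `|z i 0|.
  rewrite mxE ffunE /=; case: ltrP => [zi0|zi0].
    by rewrite expr1 ltr0_norm// mulN1r mulNr mulrN.
  by rewrite expr0 mul1r ger0_norm.
have kz0 : 0 <= dot (kv f) z.
  by apply: sumr_ge0 => i _; rewrite kz mulr_ge0.
have /= := hx (hs f) (codom_f hs f).
apply/negP; rewrite -leNgt dotZl dot_mulmxl trmxK -/g.
have -> : g = (l2norm g / (c * s)) *: z.
  rewrite scalerA.
  have -> : l2norm g / (c * s) * (c * s / l2norm g) = 1 by field; rewrite !gt_eqF.
  by rewrite scale1r.
rewrite dotZr.
(* Since [s <= l2norm g], passing from [z] back to [c *: g] multiplies the nonnegative pairing by
   [l2norm g / s >= 1]. *)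
apply: (@le_trans _ _ (dot (kv f) z)); last first.
  have -> : c * (l2norm g / (c * s) * dot (kv f) z) = l2norm g / s * dot (kv f) z.
    by field; rewrite !gt_eqF.
  by rewrite ler_peMl// ler_pdivlMr// mul1r.
rewrite -zn !sqr_l2norm.
have -> : q%:R = \sum_(i < q) 1 :> R by rewrite sumr_const card_ord.
rewrite /dot !mulr_suml -sumrB -big_split /=; apply: ler_sum => i _.
rewrite kz.
have -> : kv f i 0 * kv f i 0 = (Num.truncn `|z i 0|)%:R ^+ 2.
  by rewrite mxE ffunE /= mulrACA -signr_addb addbb mul1r expr2.
rewrite -expr2 -(real_normK (num_real (z i 0))).
(* In each coordinate [(a - n)^2 <= 1] reads [a^2 / 2 - 1 / 2 + n^2 / 2 <= n a]; this is where the
   [q / 2] in the thresholds comes from. *)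
have /andP[] := truncn_itv (normr_ge0 (z i 0)).
set a := `|z i 0|; set n := Num.truncn a; rewrite -natr1.
move=> h1 h2; have : (a - n%:R) ^+ 2 <= 1 by nra.
lra.
Qed.

End net.

(** * Pseudoinverses and partial least squares *)

(** The rank hypothesis forces [X] to have full column rank and its range to meet that of [Y] only
    in 0; [X *m x] lies in both. Transposes appear because subspaces are represented as row
    spaces. *)
Lemma row_mx_rank_inj (F : fieldType) (k a b : nat) (X : 'M[F]_(k, a))
    (Y : 'M[F]_(k, b)) (x : 'cV[F]_a) (y : 'cV[F]_b) :
  (a + \rank Y <= \rank (row_mx X Y))%N -> X *m x + Y *m y = 0 -> x = 0.
Proof.
rewrite -(mxrank_tr (row_mx X Y)) -(mxrank_tr Y) tr_row_mx -addsmxE => rXY xy.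
have h1 := mxrank_sum_cap X^T Y^T.
have h2 : (\rank X^T <= a)%N by exact: rank_leq_row.
have hX : \rank X^T = a by lia.
have cap0 : (X^T :&: Y^T)%MS = 0.
  by apply/eqP; rewrite -mxrank_eq0; apply/eqP; lia.
apply: trmx_inj; rewrite trmx0.
have fX : row_free X^T by apply/eqP.
apply: (row_free_inj fX); rewrite mul0mx; apply/eqP.
rewrite -submx0 -cap0 sub_capmx submxMl -trmx_mul.
have -> : X *m x = Y *m (- y) by rewrite mulmxN; apply/eqP; rewrite -addr_eq0 xy.
by rewrite trmx_mul submxMl.
Qed.

Section pseudoinverse.
Context (R : realType).

Lemma mulmx_col_inj (k l : nat) (A B : 'M[R]_(k, l)) :
  (forall x : 'cV_l, A *m x = B *m x) -> A = B.
Proof.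
move=> h; apply/matrixP => i j.
by have /colP/(_ i) := h (delta_mx j 0); rewrite -!colE !mxE.
Qed.

Lemma gram_cancel (k l r : nat) (A : 'M[R]_(k, l)) (Z : 'M[R]_(l, r)) :
  A^T *m (A *m Z) = 0 -> A *m Z = 0.
Proof.
move=> h; apply: mulmx_col_inj => x; rewrite mul0mx; apply: dot_eq0.
by rewrite -mulmxA dot_mulmxl (mulmxA A Z) (mulmxA A^T) h mul0mx dot0r.
Qed.

Lemma mp_invZ (k l : nat) (A : 'M[R]_(k, l)) (a : R) : a != 0 ->
  mp_inv (a *: A) = a^-1 *: mp_inv A.
Proof.
move=> a0; apply: penrose_uniq (mp_invP _) _.
have [h1 h2 h3 h4] := mp_invP A.
have e1 : (a *: A) *m (a^-1 *: mp_inv A) = A *m mp_inv A.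
  by rewrite -scalemxAl -scalemxAr scalerA divff// scale1r.
have e2 : (a^-1 *: mp_inv A) *m (a *: A) = mp_inv A *m A.
  by rewrite -scalemxAl -scalemxAr scalerA mulVf// scale1r.
by split; rewrite ?e1 ?e2 -?scalemxAr ?h1 ?h2.
Qed.

Lemma penrose_tr (k l : nat) (A : 'M[R]_(k, l)) X :
  penrose A X -> penrose A^T X^T.
Proof.
move=> [h1 h2 h3 h4]; split.
- by rewrite -!trmx_mul mulmxA h1.
- by rewrite -!trmx_mul mulmxA h2.
- by rewrite -!trmx_mul !h4.
- by rewrite -!trmx_mul !h3.
Qed.

Lemma mp_inv_sym (k : nat) (G : 'M[R]_k) : G^T = G -> (mp_inv G)^T = mp_inv G.
Proof.
move=> sG; apply: penrose_uniq (mp_invP G).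
by have := penrose_tr (mp_invP G); rewrite sG.
Qed.

Section gram.
Context (k l : nat) (A : 'M[R]_(k, l)).
Let G := A^T *m A.

Lemma gram_sym : G^T = G. Proof. by rewrite /G trmx_mul trmxK. Qed.

Lemma mulmx_gram_mp_inv : A *m mp_inv G *m G = A.
Proof.
have [h1 _ _ _] := mp_invP G.
apply/eqP; rewrite -subr_eq0; apply/eqP.
rewrite -[X in _ - X]mulmx1 -mulmxA -mulmxBr; apply: gram_cancel.
by rewrite mulmxA -/G mulmxBr mulmx1 mulmxA h1 subrr.
Qed.

(** True at any rank, by uniqueness in the Penrose equations. It links the OLS pseudoinverse to the
    Gram matrix of the assumptions and of the optimality conditions. *)
Lemma mp_inv_gram : mp_inv A = mp_inv G *m A^T.
Proof.
apply: penrose_uniq (mp_invP _) _.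
have [h1 h2 h3 h4] := mp_invP G; have sGp := mp_inv_sym gram_sym.
split.
- by rewrite !mulmxA -[_ *m A^T *m A]mulmxA mulmx_gram_mp_inv.
- by rewrite !mulmxA -[_ *m A^T *m A]mulmxA -/G h2.
- by rewrite !trmx_mul trmxK sGp mulmxA.
- by rewrite -mulmxA -/G h4.
Qed.

Lemma mulmx_mp_inv_gram : mp_inv A *m A = mp_inv G *m G.
Proof. by rewrite mp_inv_gram -mulmxA. Qed.

End gram.

(** Orthogonal projection onto the complement of the range of [A]. The matrix [M] of A2 is the one
    for [Psi0]; the exclusion of inactive inputs uses the one for [PsiS]. *)
Definition coproj (k l : nat) (A : 'M[R]_(k, l)) : 'M[R]_k :=
  1%:M - A *m mp_inv A.

Section coproj_theory.
Context (k l : nat) (A : 'M[R]_(k, l)).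

Lemma coproj_sym : (coproj A)^T = coproj A.
Proof.
by have [_ _ h _] := mp_invP A; rewrite /coproj linearB /= trmx1 h.
Qed.

Lemma coproj_mul0 : coproj A *m A = 0.
Proof.
by have [h _ _ _] := mp_invP A; rewrite mulmxBl mul1mx h subrr.
Qed.

Lemma coproj_idem : coproj A *m coproj A = coproj A.
Proof. by rewrite {2}/coproj mulmxBr mulmx1 mulmxA coproj_mul0 mul0mx subr0. Qed.

Lemma l2norm_coproj (x : 'cV[R]_k) : l2norm (coproj A *m x) <= l2norm x.
Proof.
rewrite l2norm_le ?l2norm_ge0// sqr_l2norm dot_mulmxl coproj_sym mulmxA coproj_idem.
have : 0 <= dot (x - coproj A *m x) (x - coproj A *m x) by exact: dot_sqr_ge0.
rewrite !(dotBl, dotBr) [dot (_ *m x) (_ *m x)]dot_mulmxl coproj_sym mulmxA coproj_idem.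
rewrite (dotC (_ *m _) x); lra.
Qed.

End coproj_theory.

(* [X0] may be rank deficient; what makes the coefficients of [X1] estimable
   is that they are determined by [X1 *m x + X0 *m w]. *)
Section partial_ols.
Context (k a b : nat) (X1 : 'M[R]_(k, a)) (X0 : 'M[R]_(k, b)).
Let X := row_mx X1 X0.
Let Pi : 'M[R]_(a, a + b) := row_mx 1%:M 0.
Let L := X1^T *m coproj X0 *m X1.
Hypothesis identif : forall (x : 'cV_a) (w : 'cV_b), X1 *m x + X0 *m w = 0 -> x = 0.

(** [mp_inv X *m X *m z - z] is in the kernel of [X], so [identif] makes its first block vanish. *)
Lemma partial_ols_unbiased : Pi *m mp_inv X *m X = Pi.
Proof.
have [h _ _ _] := mp_invP X.
apply: mulmx_col_inj => z; apply/eqP; rewrite -subr_eq0; apply/eqP.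
rewrite -!mulmxA -mulmxBr; set e := _ - z.
have Xe : X *m e = 0 by rewrite mulmxBr !mulmxA h subrr.
have : X1 *m usubmx e + X0 *m dsubmx e = 0.
  by rewrite -mul_row_col vsubmxK.
by move/identif => e0; rewrite -(vsubmxK e) mul_row_col mul1mx mul0mx e0 addr0.
Qed.

(** A kernel vector [x] of [L] satisfies [coproj X0 *m X1 *m x = 0], so [X1 *m x] is in the range of
    [X0], which [identif] allows only for [x = 0]. The pseudoinverse of [L] is thus an inverse. *)
Lemma partial_gram_unit : L \in unitmx.
Proof.
rewrite -row_free_unit -kermx_eq0; apply/rowV0P => x /sub_kermxP xL.
have LT : L^T = L by rewrite /L !trmx_mul trmxK coproj_sym mulmxA.
have Lx : L *m x^T = 0 by rewrite -LT -trmx_mul xL trmx0.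
have Mx : coproj X0 *m (X1 *m x^T) = 0.
  apply: dot_eq0; rewrite dot_mulmxl coproj_sym (mulmxA (coproj _)) coproj_idem.
  by rewrite dot_mulmxl !mulmxA Lx dot0r.
apply: trmx_inj; rewrite trmx0.
apply: (@identif _ (- (mp_inv X0 *m X1 *m x^T))).
by move: Mx; rewrite mulmxBl mul1mx mulmxN !mulmxA.
Qed.

Lemma partial_ols_cov :
  (Pi *m mp_inv X) *m (Pi *m mp_inv X)^T = mp_inv L.
Proof.
have uL := partial_gram_unit.
have LT : L^T = L by rewrite /L !trmx_mul trmxK coproj_sym mulmxA.
(* The Frisch-Waugh formula. Both sides give [Pi] when multiplied by [X] on the right, and both are
   unchanged by right multiplication by the projection [X *m mp_inv X]; these two facts determine a
   matrix. *)
have WE : Pi *m mp_inv X = invmx L *m X1^T *m coproj X0.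
  set W := Pi *m mp_inv X; set W' := _ *m coproj X0.
  have W'X : W' *m X = Pi.
    rewrite /W' /X mul_mx_row -(mulmxA _ _ X0) coproj_mul0 mulmx0.
    by rewrite -[_ *m coproj X0 *m X1]mulmxA -[_ *m X1^T *m _]mulmxA (mulmxA X1^T) -/L mulVmx.
  have WP : W *m (X *m mp_inv X) = W.
    by have [_ h _ _] := mp_invP X; rewrite /W -!mulmxA (mulmxA (mp_inv X)) h.
  have cX1 : coproj X0 *m X1 = X *m col_mx 1%:M (- (mp_inv X0 *m X1)).
    by rewrite mul_row_col mulmx1 mulmxN mulmxBl mul1mx mulmxA.
  have W'P : W' *m (X *m mp_inv X) = W'.
    have [h _ h3 _] := mp_invP X.
    apply: trmx_inj; rewrite trmx_mul h3 /W' !trmx_mul trmxK coproj_sym.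
    by rewrite !mulmxA -[_ *m coproj X0 *m X1]mulmxA cX1 !mulmxA h.
  by rewrite -WP -W'P !mulmxA W'X partial_ols_unbiased.
rewrite WE !trmx_mul trmxK coproj_sym trmx_inv LT !mulmxA.
rewrite -[_ *m coproj X0 *m coproj X0]mulmxA coproj_idem.
rewrite -[_ *m coproj X0 *m X1]mulmxA -[_ *m X1^T *m _]mulmxA (mulmxA X1^T) -/L mulVmx// mul1mx.
apply: penrose_uniq (mp_invP _).
split; rewrite ?mulmxV ?mulVmx ?mul1mx ?trmx1//.
Qed.

Lemma partial_ols_bound (tau : R) (h : 'cV[R]_a) : 0 <= tau ->
  l2norm (mp_inv L *m h) <= tau ^+ 2 * l2norm h ->
  l2norm ((Pi *m mp_inv X)^T *m h) <= tau * l2norm h.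
Proof.
move=> t0 ht; rewrite l2norm_le ?mulr_ge0 ?l2norm_ge0//.
rewrite dot_mulmxl trmxK mulmxA partial_ols_cov.
apply: le_trans (cauchy_schwarz _ _) _.
apply: (@le_trans _ _ (l2norm h * (tau ^+ 2 * l2norm h))); last by lra.
by rewrite ler_wpM2l ?l2norm_ge0.
Qed.

End partial_ols.

Section split_ols.
Context (k a b l : nat) (e : (a + b = l)%N) (X : 'M[R]_(k, l)) (Pi : 'M[R]_(a, l)).
Context (X1 : 'M[R]_(k, a)) (X0 : 'M[R]_(k, b)).
Hypotheses (XE : X = castmx (erefl, e) (row_mx X1 X0))
           (PiE : Pi = castmx (erefl, e) (row_mx 1%:M 0)).
Hypothesis kerX : forall z : 'cV_l, X *m z = 0 -> Pi *m z = 0.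

Let identif (x : 'cV_a) (w : 'cV_b) : X1 *m x + X0 *m w = 0 -> x = 0.
Proof.
move: X Pi XE PiE kerX; case: _ / e => ? ? -> ->; rewrite !castmx_id => ker.
rewrite -mul_row_col => /ker.
by rewrite mul_row_col mul1mx mul0mx addr0.
Qed.

(** The two column counts agree only propositionally. With [e] kept abstract, eliminating it removes
    the casts and leaves the block statement. *)
Lemma split_ols_unbiased : Pi *m mp_inv X *m X = Pi.
Proof.
move: X Pi XE PiE; case: _ / e => ? ? -> ->; rewrite !castmx_id.
exact: partial_ols_unbiased identif.
Qed.

Lemma split_ols_bound (tau : R) (h : 'cV[R]_a) : 0 <= tau ->
  l2norm (mp_inv (X1^T *m coproj X0 *m X1) *m h) <= tau ^+ 2 * l2norm h ->
  l2norm ((Pi *m mp_inv X)^T *m h) <= tau * l2norm h.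
Proof.
move: X Pi XE PiE; case: _ / e => ? ? -> ->; rewrite !castmx_id.
exact: partial_ols_bound identif _ _.
Qed.

End split_ols.

End pseudoinverse.

(** * Block Toeplitz matrices and delays *)

Section toeplitz.
Context (R : realType) (n m p : nat).
Context (A : 'M[R]_n) (B : 'M[R]_(n, m)) (C : 'M[R]_(p, n)) (Q : {set 'I_m}).

(* [Defs.markov] has to be qualified: [all_analysis] also exports a [markov]. *)
Definition conv (w : nat -> 'cV[R]_#|Q|) (a : nat) : 'cV[R]_p :=
  \sum_(b < a.+1) Defs.markov A C (colset B Q) (a - b) *m w b.

Lemma toep_mx_mul q (w : nat -> 'cV[R]_#|Q|) :
  toep_mx A B C Q q *m (\mxcol_(b < q) w b) = \mxcol_(a < q) conv w a.
Proof.
rewrite mul_mxblock_mxrow; apply: eq_mxcol => a.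
rewrite /conv (big_ord_widen _ (fun b => Defs.markov A C (colset B Q)
  (a - b)%N *m w b) (ltn_ord a)).
rewrite [RHS]big_mkcond; apply: eq_bigr => b _.
by rewrite ltnS; case: ifP => _; rewrite ?mul0mx.
Qed.

Lemma toep_mx_recl q :
  toep_mx A B C Q q.+1 = castmx (erefl, mxsize_recl)
    (row_mx (\mxcol_(a < q.+1) Defs.markov A C (colset B Q) a)
       (\mxblock_(a < q.+1, b < q) (if (b < a)%N then
          Defs.markov A C (colset B Q) (a - b.+1)%N else 0))).
Proof.
rewrite /toep_mx mxblock_recl; congr (castmx _ (row_mx _ _)).
  by apply: eq_mxcol => a; rewrite /= subn0.
Qed.

(** Without its first block column, the Toeplitz matrix is a zero block row above the Toeplitz
    matrix of one size less; this yields the second rank in [is_eta]. *)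
Lemma toep_mx_tail_rank q :
  \rank (\mxblock_(a < q.+1, b < q) (if (b < a)%N then
          Defs.markov A C (colset B Q) (a - b.+1)%N else 0)) =
  \rank (toep_mx A B C Q q).
Proof.
rewrite mxblock_recu; set Z := \mxblock_(i, j) _.
have -> : Z = toep_mx A B C Q q.
  by apply: eq_mxblock => a b; rewrite lift0 ltnS subSS.
have -> : \mxrow_(b < q) (if (b < @ord0 q)%N then
    Defs.markov A C (colset B Q) (@ord0 q - b.+1)%N else 0) = 0.
  by rewrite -[RHS]mxrow0; apply: eq_mxrow.
move: (toep_mx _ _ _ _ _) => Y; move: (@mxsize_recl q _) => e.
case: _ / e; rewrite castmx_id.
by rewrite -addsmxE adds0mx.
Qed.

(** A rank jump of [#|Q|] makes the first block column independent of the others, and of full column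
    rank. [0 < #|Q|] turns the truncated difference of ranks into a genuine one. *)
Lemma is_eta_inj d (w : nat -> 'cV[R]_#|Q|) : is_eta A B C Q d -> (0 < #|Q|)%N ->
  (forall a, (a <= d)%N -> conv w a = 0) -> w 0%N = 0.
Proof.
move=> [rk _] Q0 hw.
pose X : 'M[R]_(_, #|Q|) := \mxcol_(a < d.+1) Defs.markov A C (colset B Q) a.
pose Y := \mxblock_(a < d.+1, b < d) (if (b < a)%N then
          Defs.markov A C (colset B Q) (a - b.+1)%N else (0 : 'M[R]_(p, #|Q|))).
have rXY : \rank (row_mx X Y) = \rank (toep_mx A B C Q d.+1).
  by rewrite toep_mx_recl; move: (@mxsize_recl d _) => e; case: _ / e; rewrite castmx_id.
apply: (@row_mx_rank_inj _ _ _ _ X Y _ (\mxcol_(b < d) w b.+1)).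
  by rewrite rXY toep_mx_tail_rank; lia.
have := toep_mx_mul d.+1 w.
have -> : \mxcol_(a < d.+1) conv w a = 0.
  by rewrite -[RHS]mxcol0; apply: eq_mxcol => a; rewrite hw// -ltnS.
rewrite toep_mx_recl -/X -/Y (mxcol_recu (fun b : 'I_d.+1 => w b)).
move: (@mxsize_recl d _) => e.
rewrite -[\mxcol_j w (lift ord0 j)]/(\mxcol_(b < d) w b.+1).
move: (\mxcol_(b < d) w b.+1) X Y rXY => y X Y _.
by case: _ / e; rewrite !castmx_id mul_row_col.
Qed.

Lemma is_mu_inj k (x : 'cV[R]_n) (w : nat -> 'cV[R]_#|Q|) : is_mu A B C Q k -> (0 < n)%N ->
  (forall a, (a <= k)%N -> C *m A ^+ a *m x + conv w a = 0) -> x = 0.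
Proof.
move=> [rk _] n0 hw.
apply: (@row_mx_rank_inj _ _ _ _ (obs_mx A C k.+1) (toep_mx A B C Q k.+1)
   _ (\mxcol_(b < k.+1) w b)).
  have h a b c : (a - b = c -> 0 < c -> c + b <= a)%N by lia.
  exact: h rk n0.
rewrite toep_mx_mul mxcol_mul -mxcolD -[RHS]mxcol0.
by apply: eq_mxcol => a; rewrite hw// -ltnS.
Qed.

(** Time invariance, which makes [is_eta_inj] applicable from any starting time. *)
Lemma conv_shift (w : nat -> 'cV[R]_#|Q|) a b :
  (forall i, (i < b)%N -> w i = 0) -> conv w (b + a) = conv (fun i => w (b + i)%N) a.
Proof.
move=> w0; rewrite /conv -addnS big_split_ord /= big1 ?add0r => [|i _].
  by apply: eq_bigr => i _; rewrite subnDl.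
by rewrite w0 ?mulmx0.
Qed.

(** The initial state goes first, by [is_mu]. The inputs follow by induction on time: [w b] is
    determined by the outputs from [b] to [b + d], all observed exactly when [b <= N - d]. *)
Lemma Psi_ker N d k (x : 'cV[R]_n) (w : nat -> 'cV[R]_#|Q|) :
  (0 < n)%N -> (0 < #|Q|)%N ->
  is_eta A B C Q d -> is_mu A B C Q k -> (maxn d k <= N)%N ->
  Psi N A B C Q *m col_mx x (\mxcol_(b < N.+1) w b) = 0 ->
  x = 0 /\ forall b, (b <= N - d)%N -> w b = 0.
Proof.
move=> n0 Q0 he hm; rewrite geq_max => /andP[dN kN].
rewrite mul_row_col toep_mx_mul mxcol_mul -mxcolD => h.
have {}h a : (a <= N)%N -> C *m A ^+ a *m x + conv w a = 0.
  move=> aN; move/mxcolP/(_ (Ordinal (aN : (a < N.+1)%N))): h.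
  by rewrite mxcolK submxcol0.
have x0 : x = 0.
  by apply: (is_mu_inj hm n0) => a ak; apply: h; exact: leq_trans kN.
split=> // b; elim/ltn_ind: b => b IH bN.
have w0 i : (i < b)%N -> w i = 0 by move=> ib; apply: IH => //; lia.
rewrite -[b]addn0.
apply: (@is_eta_inj d (fun i => w (b + i)%N)) => // a ad.
rewrite -conv_shift//.
have := h (b + a)%N; rewrite x0 mulmx0 add0r; apply; lia.
Qed.

End toeplitz.

Lemma sum_ord_const (q b s : nat) : (b <= q)%N ->
  (\sum_(k < q | (k < b)%N) s = b * s)%N.
Proof.
move=> bq; rewrite -(big_ord_widen q (fun=> s) bq).
by rewrite sum_nat_const card_ord.
Qed.

Lemma Rank_const (q s : nat) (i : 'I_q) (j : 'I_s) :
  (@tagnat.Rank q (fun=> s) i j = i * s + j :> nat)%N.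
Proof. by rewrite tagnat.RankEsum sum_ord_const// ltnW. Qed.

Lemma rect_const (q s : nat) (t : 'I_(\sum_(b < q) s)) :
  (t = tagnat.sig1 t * s + tagnat.sig2 t :> nat)%N.
Proof. by rewrite [LHS]tagnat.rect sum_ord_const// ltnW. Qed.

Section columns.
Context (R : realType) (n m p N : nat).
Context (A : 'M[R]_n) (B : 'M[R]_(n, m)) (C : 'M[R]_(p, n)) (Q : {set 'I_m}).
Context (d : nat) (dN : (d <= N)%N).

Lemma Psi_size :
  (n + \sum_(b < (N - d).+1) #|Q| + \sum_(b < d) #|Q| = n + \sum_(b < N.+1) #|Q|)%N.
Proof.
rewrite !sum_nat_const !card_ord -addnA -mulnDl; congr (_ + _ * _)%N; lia.
Qed.

Lemma Psi_split :
  Psi N A B C Q = castmx (erefl, Psi_size)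
    (row_mx (Psi_left N A B C Q d) (Psi_right N A B C Q d)).
Proof.
apply: (canRL (castmxKV (erefl _) Psi_size)).
apply/matrixP => i j; rewrite castmxE cast_ord_id /=.
have [j1 ->|j1 ->] := split_ordP j.
  rewrite row_mxEl /Psi_left.
  have [j2 ->|j2 ->] := split_ordP j1.
    rewrite row_mxEl -[RHS](row_mxEl _ (toep_mx A B C Q N.+1)).
  rewrite /Psi; congr (fun_of_matrix _ _ _).
    exact: val_inj.
  rewrite row_mxEr [RHS]mxE [RHS]mxE; set k := tagnat.Rank _ _.
  have kE : k = j2 :> nat.
    rewrite Rank_const [RHS]rect_const inordK; have := ltn_ord (tagnat.sig1 j2); last by lia.
    by move=> ?; congr (_ * _ + _)%N; lia.
  move: k kE => k kE; rewrite -[RHS](row_mxEr (obs_mx A C N.+1)).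
  rewrite /Psi; congr (fun_of_matrix _ _ _).
  by apply: val_inj; rewrite /= kE.
rewrite row_mxEr [RHS]mxE [RHS]mxE; set k := tagnat.Rank _ _.
(* Block [b] of [Psi_right] is numbered [d - 1 - b], hence is block column
   [N - (d - 1 - b) = (N - d).+1 + b] of the Toeplitz matrix. *)
have kE : k = (\sum_(b < (N - d).+1) #|Q| + j1)%N :> nat.
  rewrite Rank_const sum_nat_const card_ord (rect_const j1) addnA -mulnDl inordK;
    have := ltn_ord (tagnat.sig1 j1); last by lia.
  by move=> ?; congr (_ * _ + _)%N; lia.
move: k kE => k kE; rewrite -[RHS](row_mxEr (obs_mx A C N.+1)).
  rewrite /Psi; congr (fun_of_matrix _ _ _).
by apply: val_inj; rewrite /= kE addnA.
Qed.

Lemma Pi_tilde_split :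
  Pi_tilde R n N Q d = castmx (erefl, Psi_size) (row_mx 1%:M 0).
Proof.
apply: (canRL (castmxKV (erefl _) Psi_size)).
apply/matrixP => i j; rewrite castmxE cast_ord_id /= mxE /=.
have [j1 ->|j1 ->] := split_ordP j.
  by rewrite row_mxEl mxE /= ltn_ord andbT.
rewrite row_mxEr mxE; case: eqP => //= e.
by have := ltn_ord i; rewrite e /=; lia.
Qed.

Lemma Pi_input_split : Pi_input R n N Q d = dsubmx (Pi_tilde R n N Q d).
Proof.
apply/matrixP => i j; rewrite !mxE.
have [j1 ->|j1 ->] := split_ordP j; rewrite !mxE /=.
  by case: eqP => // e; have := ltn_ord j1; lia.
by rewrite eqn_add2l ltn_add2l.
Qed.

End columns.

Lemma Pi_tildeE (R : realType) (n m N : nat) (Q : {set 'I_m}) d i j :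
  Pi_tilde R n N Q d i j = (i == j :> nat)%:R.
Proof. by rewrite mxE ltn_ord andbT. Qed.

Lemma sum_natdelta (R : realType) (l i : nat) (k : 'I_l) (y : 'I_l -> R) :
  k = i :> nat -> \sum_(j < l) (i == j)%:R * y j = y k.
Proof.
move=> <-; rewrite (bigD1 k)//= eqxx mul1r big1 ?addr0// => j jk.
by rewrite val_eqE eq_sym (negbTE jk) mul0r.
Qed.

Lemma Pi_tilde_mul (R : realType) (n m N : nat) (Q : {set 'I_m}) (d : nat)
    (i : 'I_(n + \sum_(b < (N - d).+1) #|Q|)) (k : 'I_(n + \sum_(b < N.+1) #|Q|))
    (y : 'cV[R]_(n + \sum_(b < N.+1) #|Q|)) :
  k = i :> nat -> (Pi_tilde R n N Q d *m y) i 0 = y k 0.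
Proof.
move=> ki; rewrite mxE; under eq_bigr do rewrite Pi_tildeE.
exact: (sum_natdelta (fun j => y j 0)).
Qed.

Lemma Psi_ker_Pi (R : realType) (n m p N : nat) (A : 'M[R]_n) (B : 'M[R]_(n, m))
    (C : 'M[R]_(p, n)) (Q : {set 'I_m}) (d k : nat) (z : 'cV[R]_(n + _)) :
  (0 < n)%N -> (0 < #|Q|)%N ->
  is_eta A B C Q d -> is_mu A B C Q k -> (maxn d k <= N)%N ->
  Psi N A B C Q *m z = 0 -> Pi_tilde R n N Q d *m z = 0.
Proof.
move=> n0 Q0 he hm dkN.
have dN : (d <= N)%N by apply: leq_trans dkN; exact: leq_maxl.
pose w (b : nat) := submxcol (dsubmx z) (inord b : 'I_N.+1).
have zE : z = col_mx (usubmx z) (\mxcol_(b < N.+1) w b).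
  rewrite -{1}(vsubmxK z) -{1}(submxcolK (dsubmx z)); congr col_mx.
  by apply: eq_mxcol => b; rewrite /w inord_val.
rewrite {1}zE => /(Psi_ker n0 Q0 he hm dkN)[x0 w0].
rewrite zE x0; apply/colP => i; rewrite [RHS]mxE.
have [i1 ->|i1 ->] := split_ordP i.
  by rewrite (Pi_tilde_mul (k := lshift _ i1))// col_mxEu mxE.
have i1N : (i1 < \sum_(b < N.+1) #|Q|)%N.
  apply: leq_trans (ltn_ord i1) _; rewrite !sum_nat_const !card_ord leq_mul2r.
  by rewrite ltnS leq_subr orbT.
rewrite (Pi_tilde_mul (k := rshift n (Ordinal i1N)))// col_mxEd mxE w0 ?mxE//.
have : (i1 < (N - d).+1 * #|Q|)%N.
  by apply: leq_trans (ltn_ord i1) _; rewrite sum_nat_const card_ord.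
have := rect_const (Ordinal i1N); move: (tagnat.sig1 _) (tagnat.sig2 _) => b c /= -> h.
rewrite -ltnS -(ltn_pmul2r Q0); apply: leq_ltn_trans h; exact: leq_addr.
Qed.

Section inputs.
Context (R : realType) (n m p N : nat).
Context (A : 'M[R]_n) (B : 'M[R]_(n, m)) (C : 'M[R]_(p, n)) (Q : {set 'I_m}).

(** Inputs interleaved by time, in the column order of [toep_mx], over the whole horizon; the input
    part of [stacked] is a prefix of it. *)
Definition istack (u : 'I_m -> 'cV[R]_N.+1) : 'cV[R]_(\sum_(k < N.+1) #|Q|) :=
  \mxcol_(k < N.+1) \col_(i < #|Q|) u (enum_val i) k 0.

Lemma dot_istack u w : dot (istack u) (istack w) = \sum_(j in Q) dot (u j) (w j).
Proof.
rewrite /dot exchange_big /=.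
under [RHS]eq_bigr => k _ do rewrite big_enum_val.
rewrite sig_big_dep /= (reindex _ (tagnat.sig_bij_on)) /=.
by apply: eq_bigr => i _; rewrite !mxE.
Qed.

Lemma tr_toep_mul r :
  (toep_mx A B C Q N.+1)^T *m r = istack (fun j => (input_mx N A B C j)^T *m r).
Proof.
apply/colP => s; rewrite !mxE; apply: eq_bigr => i _; rewrite !mxE.
congr (_ * _); case: ifP => _; rewrite ?mxE//.
by case: (_ - _)%N => [|l]; rewrite !mxE// ; apply: eq_bigr => k _; rewrite !mxE.
Qed.

Lemma tr_Psi_mul r : (Psi N A B C Q)^T *m r =
  col_mx ((obs_mx A C N.+1)^T *m r) (istack (fun j => (input_mx N A B C j)^T *m r)).
Proof. by rewrite tr_row_mx mul_col_mx tr_toep_mul. Qed.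

(** Passing to adjoints shows that the difference of the two sides is orthogonal to itself, which
    avoids reindexing the blocks. *)
Lemma toep_istack u :
  toep_mx A B C Q N.+1 *m istack u = \sum_(j in Q) input_mx N A B C j *m u j.
Proof.
apply/eqP; rewrite -subr_eq0; apply/eqP/dot_eq0; set e := _ - _.
rewrite {1}/e dotBl dot_mulmxl tr_toep_mul dot_istack dot_suml -sumrB.
by rewrite big1// => j _; rewrite dot_mulmxl subrr.
Qed.

Lemma noiseless_split x u : noiseless A B C x u =
  Psi N A B C Q *m col_mx x (istack u) + \sum_(j | j \notin Q) input_mx N A B C j *m u j.
Proof. by rewrite mul_row_col toep_istack -addrA /noiseless (bigID (mem Q)). Qed.

Lemma noiseless_supp x u : (forall j, j \notin Q -> u j = 0) ->
  noiseless A B C x u = Psi N A B C Q *m col_mx x (istack u).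
Proof.
move=> uQ; rewrite noiseless_split.
have -> : \sum_(j | j \notin Q) input_mx N A B C j *m u j = 0.
  by apply: big1 => j jQ; rewrite uQ// mulmx0.
exact: addr0.
Qed.

Lemma stacked_entry d (x : 'cV[R]_n) (u : 'I_m -> 'cV[R]_N.+1)
    (k : 'I_(N - d).+1) j (jQ : j \in Q) :
  dsubmx (stacked x u Q d) (tagnat.Rank k (enum_rank_in jQ j)) 0 =
  u j (inord k) 0.
Proof.
rewrite /stacked col_mxKd; set V := mxcol _; set i := enum_rank_in _ _.
have -> : V (tagnat.Rank k i) 0 = submxcol V k i 0 by rewrite [RHS]mxE.
by rewrite mxcolK mxE enum_rankK_in.
Qed.

Lemma stackedE d x u : (d <= N)%N ->
  stacked x u Q d = Pi_tilde R n N Q d *m col_mx x (istack u).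
Proof.
move=> dN; apply/colP => i.
have [i1 ->|i1 ->] := split_ordP i.
  by rewrite (Pi_tilde_mul (k := lshift _ i1))// !col_mxEu.
pose k0 : 'I_(\sum_(b < N.+1) #|Q|) :=
  tagnat.Rank (inord (tagnat.sig1 i1)) (tagnat.sig2 i1).
have k0E : k0 = i1 :> nat.
  have h := ltn_ord (tagnat.sig1 i1).
  by rewrite Rank_const [RHS]rect_const inordK// ltnS (leq_trans _ (leq_subr d N)).
have kI : istack u k0 0 = u (enum_val (tagnat.sig2 i1)) (inord (tagnat.sig1 i1)) 0.
  have -> : istack u k0 0 = submxcol (istack u) (inord (tagnat.sig1 i1)) (tagnat.sig2 i1) 0.
    by rewrite [RHS]mxE.
  by rewrite mxcolK mxE.
move: k0 k0E kI => k0 k0E kI.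
by rewrite (Pi_tilde_mul (k := rshift n k0)) ?col_mxEd ?kI ?mxE//= k0E.
Qed.

End inputs.

(** * Optimality conditions and support recovery *)

(** The limit [t -> 0] of a difference quotient, with an explicit [t] that keeps [t * b] below
    [a - c]. *)
Lemma le_limit0 (R : realType) (a b c : R) : 0 <= b ->
  (forall t : R, 0 < t <= 1 -> a <= c + t * b) -> a <= c.
Proof.
move=> b0 h; rewrite leNgt; apply/negP => ca.
pose t := Num.min 1 ((a - c) / (2 * (b + 1))).
have den : 0 < 2 * (b + 1) by lra.
have t0 : 0 < t by rewrite lt_min ltr01 divr_gt0// subr_gt0.
have t1 : t <= 1 by rewrite ge_min lexx.
have t2 : t * (2 * (b + 1)) <= a - c by rewrite -ler_pdivlMr// ge_min lexx orbT.
by have := h t; rewrite t0 t1 => /(_ isT); nra.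
Qed.

Lemma dsubmxB_entry (R : realType) (k l : nat) (a b : 'cV[R]_(k + l)) i :
  dsubmx (a - b) i 0 = dsubmx a i 0 - dsubmx b i 0.
Proof. by rewrite !mxE. Qed.

Section lasso.
Context (R : realType) (n m p N : nat).
Context (A : 'M[R]_n) (B : 'M[R]_(n, m)) (C : 'M[R]_(p, n)).
Context (lam : R) (y : 'cV[R]_(\sum_(a < N.+1) p)).
Context (x : 'cV[R]_n) (u : 'I_m -> 'cV[R]_N.+1).
Hypotheses (p0 : (0 < p)%N) (lam0 : 0 <= lam).
Hypothesis opt : lasso_opt A B C lam y x u.

Let T : R := (p * N.+1)%:R.
Let J := input_mx N A B C.
Let O := obs_mx A C N.+1.
Let r := y - noiseless A B C x u.

Let T0 : 0 < T. Proof. by rewrite ltr0n muln_gt0 p0. Qed.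

Lemma noiseless_line t hx hu :
  noiseless A B C (x + t *: hx) (fun j => u j + t *: hu j) =
  noiseless A B C x u + t *: noiseless A B C hx hu :> 'cV[R]_(\sum_(a < N.+1) p).
Proof.
rewrite /noiseless mulmxDr -scalemxAr scalerDr addrACA scaler_sumr -big_split.
by congr (_ + _); apply: eq_bigr => j _; rewrite mulmxDr -scalemxAr.
Qed.

(** First-order condition without subgradients: the optimum is compared with a step of size [t],
    convexity bounds the change of penalty by [t] times that of the full step, and [t] tends to 0
    after division by [t]. *)
Lemma lasso_variational hx hu :
  dot r (noiseless A B C hx hu) <=
  T * lam * \sum_j (l2norm (u j + hu j) - l2norm (u j)).
Proof.
set e := noiseless A B C hx hu.
apply: (@le_limit0 _ _ (dot e e / 2)) => [|t /andP[t0 t1]].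
  by rewrite divr_ge0 ?dot_sqr_ge0.
have := opt (x + t *: hx) (fun j => u j + t *: hu j).
have re : y - noiseless A B C (x + t *: hx) (fun j => u j + t *: hu j) = r - t *: e.
  rewrite noiseless_line /r -/e; move: (noiseless A B C x u) (e) => a b.
  by rewrite opprD addrA.
have re2 : l2norm (r - t *: e) ^+ 2 = dot r r - 2 * t * dot r e + t ^+ 2 * dot e e.
  move: (r) (e) => r' e'.
  by rewrite sqr_l2norm !(dotBl, dotBr, dotZl, dotZr) (dotC e' r'); ring.
rewrite /lasso_obj re re2 -/r (sqr_l2norm r) -/T => h.
have hs : \sum_j l2norm (u j + t *: hu j) <=
    \sum_j l2norm (u j) + t * \sum_j (l2norm (u j + hu j) - l2norm (u j)).
  rewrite mulr_sumr -big_split; apply: ler_sum => j _ /=.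
  have -> : u j + t *: hu j = (1 - t) *: u j + t *: (u j + hu j).
    by rewrite scalerDr addrA -scalerDl subrK scale1r.
  apply: le_trans (l2normD _ _) _; rewrite !l2normZ !ger0_norm ?subr_ge0// ?(ltW t0)//.
  lra.
have {}hs := ler_wpM2l lam0 hs.
set S1 := \sum_j l2norm (u j) in h hs.
set S2 := \sum_j l2norm (u j + t *: hu j) in h hs.
set D := \sum_j (_ - _) in hs *.
have eT : 1 / (2 * T) = (2 * T)^-1 by rewrite div1r.
have {h} h : (2 * T)^-1 * (2 * t * dot r e - t ^+ 2 * dot e e) <= lam * (t * D).
  by rewrite eT in h; move: ((2 * T)^-1) h => i h; lra.
rewrite mulrC ler_pdivrMr ?mulr_gt0// in h.
rewrite -(ler_pM2l t0); lra.
Qed.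

Lemma noiseless_obs hx : noiseless A B C hx (fun=> 0) = O *m hx.
Proof.
rewrite /noiseless.
have -> : \sum_(j < m) input_mx N A B C j *m (0 : 'cV[R]_N.+1) = 0.
  by apply: big1 => j _; rewrite mulmx0.
exact: addr0.
Qed.

Lemma noiseless_input j h :
  noiseless A B C 0 (fun i => if i == j then h else 0) = J j *m h.
Proof.
rewrite /noiseless mulmx0 add0r.
have -> : \sum_(i < m) input_mx N A B C i *m (if i == j then h else 0) =
    \sum_(i < m | i == j) J i *m h.
  by rewrite [RHS]big_mkcond; apply: eq_bigr => i _; case: eqP; rewrite ?mulmx0.
exact: big_pred1_eq.
Qed.

(** The initial state is not penalized, so the direction [O^T *m r] forces this gradient to
    vanish. *)
Lemma lasso_residual_obs : O^T *m r = 0.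
Proof.
apply: dot_eq0; apply/eqP; rewrite eq_le dot_sqr_ge0 andbT.
have := lasso_variational (O^T *m r) (fun=> 0).
rewrite noiseless_obs.
have -> : \sum_j (l2norm (u j + 0) - l2norm (u j)) = 0.
  by apply: big1 => j _; rewrite addr0 subrr.
by rewrite mulr0 dotC dot_mulmxl.
Qed.

Lemma lasso_variational_input j h :
  dot ((J j)^T *m r) h <= T * lam * (l2norm (u j + h) - l2norm (u j)).
Proof.
have := lasso_variational 0 (fun i => if i == j then h else 0).
rewrite noiseless_input.
have -> : \sum_i (l2norm (u i + (if i == j then h else 0)) - l2norm (u i)) =
    \sum_(i < m | i == j) (l2norm (u i + h) - l2norm (u i)).
  rewrite [RHS]big_mkcond; apply: eq_bigr => i _.
  by case: eqP => // _; rewrite addr0 subrr.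
by rewrite big_pred1_eq dotC dot_mulmxl dotC.
Qed.

(** The direction [g] itself, with the triangle inequality for the penalty. *)
Lemma lasso_residual_input j : l2norm ((J j)^T *m r) <= T * lam.
Proof.
set g := (J j)^T *m r.
have [->|/l2norm_gt0 g0] := eqVneq g 0; first by rewrite l2norm0 mulr_ge0// ltW.
have := lasso_variational_input j g; rewrite -/g -sqr_l2norm => h.
have := ler_wpM2l (mulr_ge0 (ltW T0) lam0) (l2normD (u j) g) => h2.
by rewrite -(ler_pM2r g0); lra.
Qed.

(** The direction [- u j], which removes block [j] from the penalty. *)
Lemma lasso_residual_align j : T * lam * l2norm (u j) <= dot (u j) ((J j)^T *m r).
Proof.
have := lasso_variational_input j (- u j).
by rewrite addrN l2norm0 dotNr dotC; lra.
Qed.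

Section selection.
Context (Q : {set 'I_m}) (x0 : 'cV[R]_n) (u0 : 'I_m -> 'cV[R]_N.+1).
Context (e : 'cV[R]_(\sum_(a < N.+1) p)).
Hypothesis Q0 : (0 < #|Q|)%N.
Hypothesis u0Q : forall j, j \notin Q -> u0 j = 0.
Hypothesis yE : y = noiseless A B C x0 u0 + e.

Let X := Psi N A B C Q.
Let G := X^T *m X.
Let zeta := col_mx 0 (istack Q (fun j => (J j)^T *m r)) : 'cV[R]_(n + _).
Let Z := \sum_(j | j \notin Q) J j *m u j.

Lemma tr_Psi_residual : X^T *m r = zeta.
Proof. by rewrite /X tr_Psi_mul lasso_residual_obs. Qed.

Lemma residualE : r = X *m (col_mx x0 (istack Q u0) - col_mx x (istack Q u)) + e - Z.
Proof.
rewrite /r yE (noiseless_supp _ _ _ _ u0Q) (noiseless_split _ _ _ Q).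
by rewrite mulmxBr opprD addrA; congr (_ - _); rewrite addrAC.
Qed.

(** Summing squares over the blocks gives a factor [sqrt #|Q|]; it is rounded up to [#|Q|], which
    the [alpha / #|Q|] of A3 cancels. *)
Lemma l2norm_zeta : l2norm zeta <= T * lam * #|Q|%:R.
Proof.
have tl : 0 <= T * lam by rewrite mulr_ge0// ltW.
rewrite l2norm_le ?mulr_ge0//.
have -> : dot zeta zeta = dot (istack Q (fun j => (J j)^T *m r)) (istack Q (fun j => (J j)^T *m r)).
  rewrite /dot big_split_ord /= big1 ?add0r => [|i _].
    by apply: eq_bigr => i _; rewrite col_mxEd.
  by rewrite col_mxEu mxE mul0r.
rewrite dot_istack.
apply: (@le_trans _ _ (\sum_(j in Q) (T * lam) ^+ 2)).
  by apply: ler_sum => j _; rewrite -l2norm_le// lasso_residual_input.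
rewrite sumr_const -[leLHS]mulr_natr [(_ * #|Q|%:R) ^+ 2]exprMn ler_wpM2l ?sqr_ge0//.
by rewrite -natrX ler_nat -{1}[#|Q|]expn1 leq_pexp2l.
Qed.

Lemma lasso_no_false_inclusion alpha :
  0 <= alpha < 1 -> 0 < lam ->
  (forall j, j \notin Q ->
     l2_opnorm ((J j)^T *m X *m mp_inv G) <= alpha / #|Q|%:R) ->
  (forall j, j \notin Q -> l2norm ((J j)^T *m coproj X *m e) < T * lam * (1 - alpha)) ->
  forall j, j \notin Q -> u j = 0.
Proof.
move=> /andP[a0 a1] lam1 hA he.
have tl : 0 < T * lam by rewrite mulr_gt0.
have Q1 : 0 < #|Q|%:R :> R by rewrite ltr0n.
have cXr : coproj X *m r = coproj X *m e - coproj X *m Z.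
  by rewrite residualE mulmxBr mulmxDr mulmxA coproj_mul0 mul0mx add0r.
have rE : r = coproj X *m r + X *m mp_inv G *m zeta.
  rewrite -tr_Psi_residual mulmxA -(mulmxA X) -mp_inv_gram.
  by rewrite /coproj mulmxBl mul1mx subrK.
have bnd j : j \notin Q -> dot (u j) ((J j)^T *m r) <=
    l2norm (u j) * (alpha * (T * lam) + l2norm ((J j)^T *m coproj X *m e))
    - dot (J j *m u j) (coproj X *m Z).
  move=> jQ; rewrite {1}rE cXr mulmxDr mulmxBr !mulmxA.
  rewrite dotDr dotBr [dot (J j *m _) _]dot_mulmxl mulmxA.
  have h1 := cauchy_schwarz (u j) ((J j)^T *m coproj X *m e).
  have h2 := cauchy_schwarz (u j) ((J j)^T *m X *m mp_inv G *m zeta).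
  have h3 : l2norm ((J j)^T *m X *m mp_inv G *m zeta) <= alpha * (T * lam).
    apply: le_trans (l2_opnormP _ _) _.
    apply: (@le_trans _ _ (alpha / #|Q|%:R * (T * lam * #|Q|%:R))).
      by apply: ler_pM (hA j jQ) l2norm_zeta; rewrite ?l2_opnorm_ge0 ?l2norm_ge0.
    by rewrite le_eqVlt; apply/orP; left; apply/eqP; field; rewrite gt_eqF.
  have := ler_wpM2l (l2norm_ge0 (u j)) h3; lra.
have tot : \sum_(j | j \notin Q) l2norm (u j) *
    (T * lam * (1 - alpha) - l2norm ((J j)^T *m coproj X *m e)) <= 0.
  (* The pairings of the [J j *m u j] with the projected [Z] add up to the squared length of
     [coproj X *m Z], with a minus sign. *)
  apply: (@le_trans _ _ (- dot Z (coproj X *m Z))); last first.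
    have -> : dot Z (coproj X *m Z) = dot (coproj X *m Z) (coproj X *m Z).
      by rewrite [RHS]dot_mulmxl coproj_sym mulmxA coproj_idem.
    by rewrite oppr_le0 dot_sqr_ge0.
  rewrite {1}/Z dot_suml -sumrN; apply: ler_sum => j jQ.
  have := bnd j jQ; have := lasso_residual_align j; lra.
have nn j : j \notin Q -> 0 <= l2norm (u j) *
    (T * lam * (1 - alpha) - l2norm ((J j)^T *m coproj X *m e)).
  by move=> jQ; rewrite mulr_ge0 ?l2norm_ge0// subr_ge0 ltW// he.
move=> j jQ; apply: l2norm_eq0.
have : \sum_(j | j \notin Q) l2norm (u j) *
    (T * lam * (1 - alpha) - l2norm ((J j)^T *m coproj X *m e)) == 0.
  by rewrite eq_le tot sumr_ge0.
rewrite psumr_eq0// => /allP /(_ j (mem_index_enum _)) /implyP /(_ jQ).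
rewrite mulf_eq0 => /orP[/eqP//|]; rewrite subr_eq0 => /eqP h.
by have := he j jQ; rewrite h ltxx.
Qed.

(** Stationarity on [Q] reads [G *m b + X^T *m e = zeta] for the estimation error [b]. The input
    entries of [Pi_tilde *m b] are thus below the threshold, one term coming from the noise and one
    from [zeta]. If [u j] were 0, these entries would include all of [trunc d (u0 j)]. *)
Lemma lasso_no_false_exclusion d thr :
  (d <= N)%N -> 0 < lam -> 0 < thr ->
  Pi_tilde R n N Q d *m mp_inv X *m X = Pi_tilde R n N Q d ->
  (forall j, j \notin Q -> u j = 0) ->
  (forall i, `| dsubmx (Pi_tilde R n N Q d *m mp_inv X *m e) i 0 | < thr) ->
  forall j, j \in Q ->
    thr + lam * linf_opnorm (Pi_input R n N Q d *m mp_inv (T^-1 *: G)) <=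
      `| trunc d (u0 j) | -> u j != 0.
Proof.
move=> dN lam1 thr0 WX uQ he j jQ hj; apply/eqP => uj.
have tl : 0 < T * lam by rewrite mulr_gt0.
have Z0 : Z = 0 by apply: big1 => i iQ; rewrite uQ// mulmx0.
set b := col_mx x0 (istack Q u0) - col_mx x (istack Q u).
have gE : G *m b + X^T *m e = zeta.
  by rewrite -tr_Psi_residual residualE Z0 subr0 mulmxDr mulmxA.
pose W := Pi_tilde R n N Q d *m mp_inv X.
have bE : Pi_tilde R n N Q d *m b = Pi_tilde R n N Q d *m mp_inv G *m zeta - W *m e.
  have WE : W = Pi_tilde R n N Q d *m mp_inv G *m X^T.
    by rewrite /W (mp_inv_gram X) mulmxA.
  have PE : Pi_tilde R n N Q d *m mp_inv G *m G = Pi_tilde R n N Q d.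
    by rewrite -mulmxA -mulmx_mp_inv_gram mulmxA WX.
  by rewrite -gE mulmxDr (mulmxA _ G b) PE WE (mulmxA _ X^T e) addrK.
have key i : `| dsubmx (Pi_tilde R n N Q d *m b) i 0 | <
    thr + lam * linf_opnorm (Pi_input R n N Q d *m mp_inv (T^-1 *: G)).
  rewrite bE dsubmxB_entry.
  apply: le_lt_trans (ler_normB _ _) _; rewrite addrC ltr_leD//.
  (* Two rescalings: the pseudoinverse of [T^-1 *: G] is [T] times that of [G], and
     [(T * lam)^-1 *: zeta] lies in the unit ball of the l_oo norm. *)
  have -> : dsubmx (Pi_tilde R n N Q d *m mp_inv G *m zeta) =
      lam *: (Pi_input R n N Q d *m mp_inv (T^-1 *: G) *m ((T * lam)^-1 *: zeta)).
    rewrite mp_invZ ?invr_eq0 ?gt_eqF// invrK -scalemxAr -scalemxAr -scalemxAl !scalerA.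
    have -> : lam * ((T * lam)^-1 * T) = 1.
      by rewrite mulrCA (mulrC lam) mulVf ?gt_eqF.
    by rewrite scale1r Pi_input_split// !mul_dsub_mx.
  rewrite mxE normrM gtr0_norm// ler_wpM2l//.
  apply: le_trans (mx_norm_entry _ _) _; apply: linf_opnormP.
  apply: mx_norm_le => // k; rewrite mxE normrM gtr0_norm ?invr_gt0//.
  rewrite mulrC ler_pdivrMr// mul1r.
  have [k1 ->|k1 ->] := split_ordP k.
    by rewrite col_mxEu mxE normr0 ltW.
  rewrite col_mxEd /istack mxE mxE.
  exact: le_trans (l2norm_entry _ _) (lasso_residual_input _).
apply/negP: hj; rewrite -ltNge.
set bet := thr + _ in key *.
(* Positivity serves [bigmax_lt], whose maximum starts from 0. *)
have bet0 : 0 < bet.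
  have := key (tagnat.Rank ord0 (enum_rank_in jQ j)).
  by apply: le_lt_trans.
rewrite [ltLHS]/Num.norm/= mx_normrE; apply: bigmax_lt => // -[k o] _ /=; rewrite (ord1 o).
have := key (tagnat.Rank k (enum_rank_in jQ j)).
rewrite mulmxBr -!stackedE// dsubmxB_entry !stacked_entry uj.
by rewrite [X in _ - X]mxE subr0 mxE.
Qed.

End selection.

End lasso.

Lemma ols_error (R : realType) (n m p N : nat)
    (A : 'M[R]_n) (B : 'M[R]_(n, m)) (C : 'M[R]_(p, n)) (Q : {set 'I_m}) d
    x0 (u0 : 'I_m -> 'cV[R]_N.+1) e :
  (d <= N)%N -> (forall j, j \notin Q -> u0 j = 0) ->
  Pi_tilde R n N Q d *m mp_inv (Psi N A B C Q) *m Psi N A B C Q = Pi_tilde R n N Q d ->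
  stacked x0 u0 Q d - ols A B C Q d (noiseless A B C x0 u0 + e) =
  - (Pi_tilde R n N Q d *m mp_inv (Psi N A B C Q) *m e).
Proof.
move=> dN u0Q WX; rewrite stackedE// /ols (noiseless_supp _ _ _ _ u0Q).
by rewrite mulmxA mulmxDr mulmxA WX opprD addrA subrr add0r.
Qed.

(** * Tail probabilities *)

Lemma entry_halfspaces (R : realType) (q k : nat) (W : 'M[R]_(q, k))
    (sigma tau thr : R) :
  0 <= sigma -> 0 < tau -> 0 < thr ->
  (forall h : 'cV[R]_q, sigma * l2norm (W^T *m h) <= tau * l2norm h) ->
  exists L : seq ('cV[R]_k * R),
    \sum_(h <- L) expR (sigma ^+ 2 / 2 * l2norm h.1 ^+ 2 - h.2) <=
      2 * q%:R * expR (- (thr ^+ 2 / (2 * tau ^+ 2))) /\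
    forall x, (forall h, h \in L -> dot h.1 x < h.2) ->
      forall i, `|(W *m x) i 0| < thr.
Proof.
move=> s0 t0 thr0 hW.
(* [th] minimizes the Chernoff exponent [tau^2 th^2 / 2 - th thr]; each entry gets one half-space
   per sign. *)
pose th := thr / tau ^+ 2.
have th0 : 0 < th by rewrite divr_gt0 ?exprn_gt0.
pose hs (c : bool * 'I_q) :=
  ((-1) ^+ c.1 * th *: (W^T *m delta_mx c.2 0), th * thr) : 'cV[R]_k * R.
exists [seq hs c | c : (bool * 'I_q)%type]; split.
  rewrite big_image /=.
  have bnd c : expR (sigma ^+ 2 / 2 * l2norm (hs c).1 ^+ 2 - (hs c).2) <=
      expR (- (thr ^+ 2 / (2 * tau ^+ 2))).
    rewrite ler_expR /= l2normZ normrM normr_sign mul1r (gtr0_norm th0).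
    have h1 : sigma * l2norm (W^T *m delta_mx c.2 0) <= tau.
      apply: le_trans (hW _) _; rewrite -[leRHS]mulr1 ler_pM2l//.
      by rewrite l2norm_le// dot_delta mxE !eqxx expr1n.
    have h2 : (sigma * l2norm (W^T *m delta_mx c.2 0)) ^+ 2 <= tau ^+ 2.
      by rewrite ler_pXn2r ?nnegrE ?mulr_ge0 ?l2norm_ge0// ltW.
    set a := l2norm _ in h2 *.
    have -> : sigma ^+ 2 / 2 * (th * a) ^+ 2 = th ^+ 2 / 2 * (sigma * a) ^+ 2 by field.
    have h3 : th ^+ 2 / 2 * (sigma * a) ^+ 2 <= th ^+ 2 / 2 * tau ^+ 2.
      by rewrite ler_wpM2l// divr_ge0 ?sqr_ge0.
    apply: le_trans (lerB h3 (lexx _)) _.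
    rewrite le_eqVlt; apply/orP; left; apply/eqP; rewrite /th.
    by field; rewrite gt_eqF.
  apply: le_trans (ler_sum _ (fun c _ => bnd c)) _.
  by rewrite sumr_const card_prod card_bool card_ord -[leLHS]mulr_natl natrM.
move=> x hx i; have key b := hx (hs (b, i)) (codom_f hs (b, i)).
have E b : dot (hs (b, i)).1 x = th * ((-1) ^+ b * (W *m x) i 0).
  by rewrite /= dotZl dot_mulmxl trmxK dot_delta [RHS]mulrCA mulrA.
have := key true; have := key false; rewrite !E /= !ltr_pM2l// expr0 expr1 mul1r mulN1r.
by move=> h1 h2; rewrite ltr_norml h1 andbT ltrNl.
Qed.

Section tail_numerics.
Context (R : realType).

(** The subtracted term is [8 T b^2], and dropping the cross term of the square gives [T b^2 >=
    (N+1) ln 5 + ln M + T delta^2 / 4]. This pays for the lattice cost [4 (N+1)], since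
    [ln 5 >= 1 / 2], and for the union over [M] inputs. *)
Lemma dual_tail (N M T : nat) (K sigma delta b : R) :
  (0 < M)%N -> (0 < T)%N -> 0 < K -> 0 < sigma -> 0 < delta ->
  b = Num.sqrt ((N.+1%:R * ln 5 + ln M%:R) / T%:R) + delta / 2 ->
  M%:R * expR (4 * N.+1%:R - (T%:R * (Num.sqrt 32 * K * sigma * b)) ^+ 2 /
    (4 * (sigma * K * Num.sqrt T%:R) ^+ 2)) <= expR (- (T%:R * delta ^+ 2 / 2)).
Proof.
move=> M0 T0 K0 s0 d0 hb.
have Tr : 0 < T%:R :> R by rewrite ltr0n.
have Mr : 1 <= M%:R :> R by rewrite ler1n.
have lM : 0 <= ln M%:R :> R by rewrite ln_ge0.
have l5 : 1 / 2 <= ln 5 :> R.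
  rewrite -ler_expR lnK ?posrE//.
  have h : expR (- (1 / 2)) * expR (1 / 2) = 1 :> R by rewrite -expRD addNr expR0.
  have := expR_ge1Dx (- (1 / 2) : R); have := expR_gt0 (1 / 2 : R); nra.
set a := N.+1%:R * ln 5 + ln M%:R in hb.
have N1 : 1 <= N.+1%:R :> R by rewrite ler1n.
have a0 : 0 <= a by rewrite addr_ge0// mulr_ge0//; lra.
have bE : a / T%:R + delta ^+ 2 / 4 <= b ^+ 2.
  rewrite hb sqrrD sqr_sqrtr ?divr_ge0 ?(ltW Tr)//.
  have := mulr_ge0 (sqrtr_ge0 (a / T%:R)) (ltW d0); lra.
have -> : (T%:R * (Num.sqrt 32 * K * sigma * b)) ^+ 2 /
    (4 * (sigma * K * Num.sqrt T%:R) ^+ 2) = 8 * (T%:R * b ^+ 2).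
  rewrite !exprMn !sqr_sqrtr ?(ltW Tr)//.
  have b0 : 0 < b by rewrite hb ltr_wpDl ?sqrtr_ge0 ?divr_gt0.
  by field; rewrite !gt_eqF.
have Tb : a + T%:R * delta ^+ 2 / 4 <= T%:R * b ^+ 2.
  have := ler_wpM2l (ltW Tr) bE; rewrite mulrDr mulrCA mulfV ?gt_eqF//; lra.
rewrite -{1}(lnK (x := M%:R)) ?posrE ?(lt_le_trans ltr01)// -expRD ler_expR.
have d2 : 0 <= T%:R * delta ^+ 2 by rewrite mulr_ge0 ?sqr_ge0// ltW.
have : N.+1%:R * (1 / 2) <= N.+1%:R * ln 5 :> R by rewrite ler_wpM2l.
rewrite /a in Tb; lra.
Qed.

(** The subtracted term is at least [ln t + T delta^2 / 2], and the logarithm pays for the union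
    over the [t] entries. *)
Lemma entry_tail (t T : nat) (c sigma delta thr : R) :
  (0 < t)%N -> (0 < T)%N -> 0 < c -> 0 < sigma -> 0 < delta ->
  thr = sigma / Num.sqrt c * (Num.sqrt (2 * ln t%:R / T%:R) + delta) ->
  2 * t%:R * expR (- (thr ^+ 2 / (2 * (sigma / (Num.sqrt c * Num.sqrt T%:R)) ^+ 2))) <=
  2 * expR (- (T%:R * delta ^+ 2 / 2)).
Proof.
move=> t0 T0 c0 s0 d0.
have Tr : 0 < T%:R :> R by rewrite ltr0n.
have tr : 1 <= t%:R :> R by rewrite ler1n.
have lt0 : 0 <= ln t%:R :> R by rewrite ln_ge0.
have sc : 0 < Num.sqrt c by rewrite sqrtr_gt0.
have sT : 0 < Num.sqrt T%:R :> R by rewrite sqrtr_gt0.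
rewrite -[leLHS]mulrA ler_pM2l//.
set b := Num.sqrt (2 * ln t%:R / T%:R) + delta => ->.
have bE : 2 * ln t%:R / T%:R + delta ^+ 2 <= b ^+ 2.
  rewrite /b sqrrD sqr_sqrtr ?divr_ge0 ?mulr_ge0 ?(ltW Tr)//.
  have := mulr_ge0 (sqrtr_ge0 (2 * ln t%:R / T%:R)) (ltW d0); lra.
have -> : (sigma / Num.sqrt c * b) ^+ 2 / (2 * (sigma / (Num.sqrt c * Num.sqrt T%:R)) ^+ 2) =
    Num.sqrt T%:R ^+ 2 * b ^+ 2 / 2.
  by field; rewrite !gt_eqF.
rewrite sqr_sqrtr ?(ltW Tr)//.
have Tb : 2 * ln t%:R + T%:R * delta ^+ 2 <= T%:R * b ^+ 2.
  have := ler_wpM2l (ltW Tr) bE; rewrite mulrDr mulrCA mulfV ?gt_eqF//; lra.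
rewrite -{1}(lnK (x := t%:R)) ?posrE ?(lt_le_trans ltr01)// -expRD ler_expR; lra.
Qed.

(** The subtracted term simplifies to [(2 u + w)^2] with [u^2 = q] and [w^2 = ln (1 / delta1)]; the
    first square cancels [4 q] and the second leaves [delta1]. *)
Lemma ols_tail (q T : nat) (c sigma delta1 : R) :
  (0 < T)%N -> 0 < c -> 0 < sigma -> 0 < delta1 < 1 ->
  expR (4 * q%:R -
    (4 * sigma / Num.sqrt c * Num.sqrt (q%:R / T%:R)
     + 2 * sigma / Num.sqrt c * Num.sqrt (1 / T%:R * ln (1 / delta1))) ^+ 2 /
    (4 * (sigma / (Num.sqrt c * Num.sqrt T%:R)) ^+ 2)) <= delta1.
Proof.
move=> T0 c0 s0 /andP[d0 d1].
have Tr : 0 < T%:R :> R by rewrite ltr0n.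
have sc : 0 < Num.sqrt c by rewrite sqrtr_gt0.
have sT : 0 < Num.sqrt T%:R :> R by rewrite sqrtr_gt0.
have Li : ln (1 / delta1) = - ln delta1 by rewrite div1r lnV ?posrE.
have L0 : 0 <= - ln delta1.
  by rewrite oppr_ge0 -ln1 ler_ln ?posrE// ltW.
rewrite Li div1r sqrtrM ?ler0n// sqrtrM ?invr_ge0 ?ler0n// sqrtrV ?ler0n//.
set u := Num.sqrt q%:R; set w := Num.sqrt (- ln delta1).
have u2 : u ^+ 2 = q%:R by rewrite sqr_sqrtr.
have w2 : w ^+ 2 = - ln delta1 by rewrite sqr_sqrtr.
have u0 : 0 <= u by exact: sqrtr_ge0.
have w0 : 0 <= w by exact: sqrtr_ge0.
have -> : (4 * sigma / Num.sqrt c * (u / Num.sqrt T%:R) +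
    2 * sigma / Num.sqrt c * ((Num.sqrt T%:R)^-1 * w)) ^+ 2 /
    (4 * (sigma / (Num.sqrt c * Num.sqrt T%:R)) ^+ 2) = (2 * u + w) ^+ 2.
  by field; rewrite !gt_eqF.
rewrite -[leRHS]lnK ?posrE// ler_expR.
have := mulr_ge0 u0 w0; rewrite sqrrD exprMn u2 w2; lra.
Qed.

End tail_numerics.


(** * Assembly of the good event, support recovery and the OLS error bound *)

Theorem theorem6 (R : realType) (n m p N : nat)
    (A : 'M[R]_n) (B : 'M[R]_(n, m)) (C : 'M[R]_(p, n))
    (disp : measure_display) (Omega : measurableType disp)
    (P : probability Omega R)
    (v : 'I_(\sum_(k < N.+1) p) -> {RV P >-> R})
    (x0 : 'cV[R]_n) (u : 'I_m -> 'cV[R]_N.+1)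
    (d mu : nat) (sigma cmin K alpha delta delta1 : R)
    (xhat : Omega -> 'cV[R]_n) (uhat : Omega -> 'I_m -> 'cV[R]_N.+1) :
  let T := (p * N.+1)%N in
  let S := active u in
  let mstar := #|S| in
  let tS := ((N - d).+1 * mstar)%N in
  let J := input_mx N A B C in
  let PsiS := Psi N A B C S in
  let Psi1 := Psi_left N A B C S d in
  let Psi0 := Psi_right N A B C S d in
  let M := 1%:M - Psi0 *m mp_inv Psi0 in
  let c1 := ln 5 in
  let lambda := Num.sqrt 32 * K * sigma / (1 - alpha) *
    (Num.sqrt ((N.+1%:R * c1 + ln (m - mstar)%N%:R) / T%:R) + delta / 2) in
  let beta_min := sigma / Num.sqrt cmin *
      (Num.sqrt (2 * ln tS%:R / T%:R) + delta)
    + lambda * linf_opnorm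
        (Pi_input R n N S d *m mp_inv (T%:R^-1 *: (PsiS^T *m PsiS))) in
  let y := fun w => noiseless A B C x0 u + \col_i v i w in
  let Shat := fun w => active (uhat w) in
  (0 < n)%N -> (0 < m)%N -> (0 < p)%N -> (0 < N)%N ->
  0 < sigma -> 0 < cmin ->
  isotropic_gaussian v sigma ->
  S = finset (fun j : 'I_m => (j < mstar)%N) ->
  (1 <= mstar < m)%N ->
  is_eta A B C S d -> is_mu A B C S mu -> (maxn d mu <= N)%N ->
  (* A1 *)
  l2_opnorm (obs_mx A C N.+1) <= K * Num.sqrt T%:R ->
  (forall j : 'I_m, l2_opnorm (J j) <= K * Num.sqrt T%:R) ->
  (* A2 *)
  l2_opnorm (mp_inv (T%:R^-1 *: (Psi1^T *m M *m Psi1))) <= 1 / cmin ->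
  (* A3 *)
  0 <= alpha < 1 ->
  (forall j : 'I_m, j \notin S ->
    l2_opnorm ((J j)^T *m PsiS *m mp_inv (PsiS^T *m PsiS))
      <= alpha / mstar%:R) ->
  0 < delta -> 0 < delta1 < 1 ->
  (forall j : 'I_m, j \in S -> beta_min <= `| trunc d (u j) |) ->
  (forall w, lasso_opt A B C lambda (y w) (xhat w) (uhat w)) ->
  exists E : set Omega, [/\ measurable E,
    ((1 - 4 * expR (- (T%:R * delta ^+ 2 / 2)) - delta1)%:E <= P E)%E &
    forall w, E w ->
      Shat w = S /\
      l2norm (stacked x0 u (Shat w) d - ols A B C (Shat w) d (y w))
        <= 4 * sigma / Num.sqrt cmin * Num.sqrt ((n + tS)%N%:R / T%:R)
           + 2 * sigma / Num.sqrt cmin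
             * Num.sqrt (1 / T%:R * ln (1 / delta1))].
Proof.
move=> T S mstar tS J PsiS Psi1 Psi0 M c1 lambda beta_min y Shat.
move=> n0 m0 p0 N0 s0 c0 gv Sdef /andP[ms1 msm] he hm dkN A1O A1J A2.
move=> ha A3 d0 hd1 hbeta opt.
have [a0 a1] : 0 <= alpha /\ alpha < 1 by apply/andP.
have T0 : (0 < T)%N by rewrite muln_gt0 p0.
have Tr : 0 < T%:R :> R by rewrite ltr0n.
have dN : (d <= N)%N by apply: leq_trans dkN; exact: leq_maxl.
have muN : (mu <= N)%N by apply: leq_trans dkN; exact: leq_maxr.
have uS j : j \notin S -> u j = 0 by rewrite inE negbK => /eqP.
(* With [K <= 0], A1 would make the observability matrix zero; a nonzero initial state with zero
   input would then have zero output, against the finiteness of [mu]. *)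
have K0 : 0 < K.
  rewrite ltNge; apply/negP => K0.
  have O0 (z : 'cV_n) : obs_mx A C N.+1 *m z = 0.
    apply: l2norm_eq0; apply/eqP; rewrite eq_le l2norm_ge0 andbT.
    apply: le_trans (l2_opnormP _ _) _; rewrite mulr_le0_ge0 ?l2norm_ge0//.
    by rewrite (le_trans A1O)// mulr_le0_ge0 ?sqrtr_ge0.
  suff : const_mx 1 = 0 :> 'cV[R]_n.
    by move/colP/(_ (Ordinal n0)); rewrite !mxE => /eqP; rewrite oner_eq0.
  apply: (is_mu_inj (w := fun=> 0) hm n0) => a amu.
  have -> : conv A B C (fun=> (0 : 'cV_#|S|)) a = 0.
    by apply: big1 => b _; rewrite mulmx0.
  have := O0 (const_mx 1); rewrite mxcol_mul addr0.
  have aN : (a < N.+1)%N by rewrite ltnS (leq_trans amu).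
  by move/mxcolP/(_ (Ordinal aN)); rewrite mxcolK submxcol0.
pose b := Num.sqrt ((N.+1%:R * ln 5 + ln (m - mstar)%N%:R) / T%:R) + delta / 2.
have b0 : 0 < b by rewrite ltr_wpDl ?sqrtr_ge0 ?divr_gt0.
have lamE : lambda * (1 - alpha) = Num.sqrt 32 * K * sigma * b.
  by rewrite /lambda -/b mulrAC divfK// gt_eqF// subr_gt0.
have slam : 0 < Num.sqrt 32 * K * sigma * b by rewrite !mulr_gt0// sqrtr_gt0.
have lam0 : 0 < lambda by rewrite -lamE pmulr_lgt0 ?subr_gt0 in slam.
pose W := Pi_tilde R n N S d *m mp_inv PsiS.
have ker (z : 'cV_(n + _)) : PsiS *m z = 0 -> Pi_tilde R n N S d *m z = 0.
  exact: (Psi_ker_Pi n0 ms1 he hm dkN).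
have WX : W *m PsiS = Pi_tilde R n N S d.
  exact: (split_ols_unbiased (Psi_split A B C S dN) (Pi_tilde_split R n S dN) ker).
have sc : 0 < Num.sqrt cmin by rewrite sqrtr_gt0.
have sT : 0 < Num.sqrt T%:R :> R by rewrite sqrtr_gt0.
(* The covariance of the OLS error is [sigma^2 / T] times the pseudoinverse bounded in A2, hence at
   most [sigma^2 / (cmin T) = tau^2] in every direction. *)
pose tau := sigma / (Num.sqrt cmin * Num.sqrt T%:R).
have tau0 : 0 < tau by rewrite divr_gt0// mulr_gt0.
have hW h : sigma * l2norm (W^T *m h) <= tau * l2norm h.
  rewrite -mulrA ler_pM2l//.
  apply: (split_ols_bound (Psi_split A B C S dN) (Pi_tilde_split R n S dN) ker).
    by rewrite invr_ge0 ltW ?mulr_gt0.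
  rewrite exprVn exprMn !sqr_sqrtr ?(ltW c0) ?(ltW Tr)// invfM -mulrA mulrCA.
  rewrite -(ler_pM2l Tr) mulVKf ?gt_eqF// -[X in X * _](gtr0_norm Tr) -l2normZ.
  rewrite scalemxAl -[X in X *: _]invrK -mp_invZ ?invr_eq0 ?gt_eqF//.
  apply: le_trans (l2_opnormP _ _) _.
  by rewrite ler_wpM2r ?l2norm_ge0// -[leRHS]div1r.
pose s := T%:R * (Num.sqrt 32 * K * sigma * b).
have sg : 0 < s by rewrite mulr_gt0.
have sKT : 0 < sigma * K * Num.sqrt T%:R by rewrite !mulr_gt0.
(* The projection is a contraction, so A1 for [J j] bounds the scale of the projected noise. *)
have hWA j h : sigma * l2norm (((J j)^T *m coproj PsiS)^T *m h) <=
    sigma * K * Num.sqrt T%:R * l2norm h.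
  rewrite -!mulrA ler_pM2l// trmx_mul trmxK coproj_sym -mulmxA.
  apply: le_trans (l2norm_coproj _ _) _; apply: le_trans (l2_opnormP _ _) _.
  by rewrite mulrA ler_wpM2r ?l2norm_ge0.
have [LA hLA] := boolp.choice (P := fun j (L : seq ('cV[R]_(\sum_(k < N.+1) p) * R)) =>
    \sum_(h <- L) expR (sigma ^+ 2 / 2 * l2norm h.1 ^+ 2 - h.2) <=
      expR (4 * N.+1%:R - s ^+ 2 / (4 * (sigma * K * Num.sqrt T%:R) ^+ 2)) /\
    forall x, (forall h, h \in L -> dot h.1 x < h.2) ->
      l2norm ((J j)^T *m coproj PsiS *m x) < s) (fun j : 'I_m =>
    lattice_halfspaces sKT sg (hWA j) (ltW s0)).
have hWd h : sigma * l2norm ((dsubmx W)^T *m h) <= tau * l2norm h.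
  have -> : (dsubmx W)^T *m h = W^T *m col_mx 0 h.
    by rewrite -{2}[W]vsubmxK tr_col_mx mul_row_col mulmx0 add0r.
  apply: le_trans (hW _) _; rewrite ler_pM2l// l2norm_le ?l2norm_ge0// sqr_l2norm.
  rewrite /dot big_split_ord /= big1 ?add0r => [|i _].
    by apply: ler_sum => i _; rewrite col_mxEd.
  by rewrite col_mxEu mxE mul0r.
pose thr := sigma / Num.sqrt cmin * (Num.sqrt (2 * ln tS%:R / T%:R) + delta).
have thr0 : 0 < thr by rewrite mulr_gt0 ?divr_gt0// ltr_wpDl ?sqrtr_ge0.
have [LB [sLB hLB]] := entry_halfspaces (ltW s0) tau0 thr0 hWd.
pose s3 := 4 * sigma / Num.sqrt cmin * Num.sqrt ((n + tS)%N%:R / T%:R)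
  + 2 * sigma / Num.sqrt cmin * Num.sqrt (1 / T%:R * ln (1 / delta1)).
have s30 : 0 < s3.
  rewrite ltr_wpDr//; first by rewrite !mulr_ge0 ?sqrtr_ge0 ?invr_ge0 ?ltW.
  by rewrite mulr_gt0 ?divr_gt0 ?mulr_gt0 ?sqrtr_gt0 ?divr_gt0// ltr0n addn_gt0 n0.
have [LC [sLC hLC]] := lattice_halfspaces tau0 s30 hW (ltW s0).
have tE : (\sum_(k < (N - d).+1) #|S| = tS)%N by rewrite sum_nat_const card_ord.
have tS0 : (0 < tS)%N by rewrite muln_gt0.
(* Three groups of constraints: the projected noise seen by each inactive input, the entries of the
   input error, and the norm of the whole OLS error. *)
pose L := flatten [seq LA j | j <- enum (~: S)%SET] ++ LB ++ LC.
have [B0 [mB PB hB]] := gaussian_halfspaces s0 gv L.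
(* The good event depends only on half-spaces of the noise, so it is measurable whichever optimum is
   selected at each outcome. *)
exists (~` B0); split; first exact: measurableC.
  have PBf : P B0 = (fine (P B0))%:E by rewrite fineK// fin_num_measure.
  rewrite probability_setC// PBf -EFinB lee_fin.
  move: PB; rewrite PBf lee_fin !big_cat big_flatten big_map /= => PB.
  have cS : #|(~: S)%SET| = (m - mstar)%N.
    by apply: (@addnI mstar); rewrite subnKC ?(ltnW msm)// cardsC card_ord.
  have hA : \sum_(j <- enum (~: S)%SET)
      \sum_(h <- LA j) expR (sigma ^+ 2 / 2 * l2norm h.1 ^+ 2 - h.2) <=
      expR (- (T%:R * delta ^+ 2 / 2)).
    have mS : (0 < m - mstar)%N by rewrite subn_gt0.
    apply: (le_trans _ (dual_tail mS T0 K0 s0 d0 (erefl b))).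
    rewrite big_enum; apply: le_trans (ler_sum _ (fun j _ => (hLA j).1)) _.
    by rewrite sumr_const cS -[leLHS]mulr_natl.
  have hBB : \sum_(h <- LB) expR (sigma ^+ 2 / 2 * l2norm h.1 ^+ 2 - h.2) <=
      2 * expR (- (T%:R * delta ^+ 2 / 2)).
    apply: le_trans sLB _; rewrite tE.
    exact: (entry_tail tS0 T0 c0 s0 d0 (erefl thr)).
  have hCC : \sum_(h <- LC) expR (sigma ^+ 2 / 2 * l2norm h.1 ^+ 2 - h.2) <= delta1.
    by apply: le_trans sLC _; rewrite tE; exact: ols_tail.
  (* The groups cost one exponential, two exponentials and [delta1]: three exponentials, within the
     four allowed. *)
  have := expR_ge0 (- (T%:R * delta ^+ 2 / 2)); lra.
move=> w nBw.
have ev := hB w nBw; set e := \col_i v i w in ev.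
have evA j : j \notin S -> l2norm ((J j)^T *m coproj PsiS *m e) < s.
  move=> jS; apply: (hLA j).2 => h hh; apply: ev; rewrite mem_cat.
  apply/orP; left; apply/flattenP; exists (LA j) => //.
  by apply: map_f; rewrite mem_enum inE.
have evB i : `|(dsubmx W *m e) i 0| < thr.
  by apply: hLB => h hh; apply: ev; rewrite !mem_cat hh orbT.
have evC : l2norm (W *m e) < s3.
  by apply: hLC => h hh; apply: ev; rewrite !mem_cat hh !orbT.
have uhS : forall j, j \notin S -> uhat w j = 0.
  apply: (lasso_no_false_inclusion p0 (ltW lam0) (opt w) ms1 uS (erefl (y w)) ha lam0 A3).
  by move=> j jS; rewrite -mulrA lamE; exact: evA.
have hS : Shat w = S.
  apply/setP => j; rewrite inE.
  have [jS|jS] := boolP (j \in S); last by rewrite uhS// eqxx.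
  apply: (lasso_no_false_exclusion p0 (ltW lam0) (opt w) uS (erefl (y w)) dN lam0 thr0 WX uhS _ jS).
    by move=> i; rewrite -mul_dsub_mx; exact: evB.
  exact: hbeta.
split=> //; rewrite hS ols_error//.
by rewrite l2normN ltW.
Qed.
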